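(* (Ring lemma) Let $\mathcal{T}_{st}$ be the standard hexagonal triangulation of the plane, with vertex set $V$ and edge set $E$, let $I:E\to(-\frac12,+\infty)$ be a weight defined on the edges, and let $v_0\in V$. Then there exists a constant $C=C(v_0,I,\mathcal{T}_{st})>0$ such that for every inversive distance circle packing $r:V\to(0,+\infty)$ for which $(\mathcal{T}_{st},I,r)$ is a geometric triangulation of the plane, $$r(v_0)\le C\,r(v_k)\qquad\text{for every vertex } v_k \text{ adjacent to } v_0.$$
   Context: The standard hexagonal triangulation $\mathcal{T}_{st}$ has vertex set the lattice $V=\{m\vec v_1+n\vec v_2:m,n\in\mathbb{Z}\}$ with $\vec v_1=1,\vec v_2=e^{i\pi/3}$, and edges joining $v$ to $v\pm\vec v_1,v\pm\vec v_2,v\pm(\vec v_1-\vec v_2)$. An inversive distance circle packing $r:V\to(0,+\infty)$ on $(\mathbb{C},\mathcal{T}_{st},I)$ is a map such that the edge lengths $$l(vv')=\sqrt{r(v)^2+r(v')^2+2I(vv')r(v)r(v')}$$ satisfy the strict triangle inequality on every face, so each face becomes a Euclidean triangle. $(\mathcal{T}_{st},I,r)$ is a geometric triangulation of the plane if it is realized by a geodesic triangulation in the plane, i.e. there is an injective continuous map from $\mathbb{C}$ to the Euclidean plane mapping each face of $\mathcal{T}_{st}$ onto a Euclidean triangle with side lengths given by $l$ (so that the images of distinct faces have disjoint interiors). *)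

(* Defs.v *)
From HB Require Import structures.
From mathcomp Require Import all_boot all_order all_algebra.
From mathcomp Require Import all_classical all_reals all_analysis.

Set Implicit Arguments.
Unset Strict Implicit.
Unset Printing Implicit Defensive.

Import Order.TTheory GRing.Theory Num.Theory.
Import numFieldNormedType.Exports.

Local Open Scope classical_set_scope.
Local Open Scope ring_scope.

(* The pair (m, n) stands for the lattice point m v1 + n v2. *)
Definition vertex : Type := (int * int)%type.

Definition neighbor (u v : vertex) : bool :=
  (v.1 - u.1, v.2 - u.2) \in
    [:: (1, 0); (-1, 0); (0, 1); (0, -1); (1, -1); (-1, 1)].

(* Every 3-cycle of the triangular lattice bounds one of its triangles:
   {v, v + v1, v + v2} or {v, v + v1, v + v1 - v2}. *)
Definition face (u v w : vertex) : bool :=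
  [&& neighbor u v, neighbor v w & neighbor w u].

(* The norm that the library puts on R * R is the maximum norm, hence a
   separate Euclidean distance. *)
Definition edist (R : realType) (p q : R * R) : R :=
  Num.sqrt ((p.1 - q.1) ^+ 2 + (p.2 - q.2) ^+ 2).

(* m v1 + n v2 with v1 = 1 and v2 = exp (i pi / 3). *)
Definition position (R : realType) (v : vertex) : R * R :=
  (v.1%:~R + v.2%:~R * cos (pi / 3), v.2%:~R * sin (pi / 3)).

Definition triangle (R : realType) (a b c : R * R) : set (R * R) :=
  [set p | exists x y z : R,
     [/\ 0 <= x, 0 <= y & 0 <= z] /\ x + y + z = 1 /\
     p = x *: a + y *: b + z *: c].

(* Weights are functions of ordered pairs of vertices, of which only the values
   on adjacent pairs matter. *)
Definition symmetric_on_edges (R : realType) (I : vertex -> vertex -> R) : Prop :=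
  forall u v, neighbor u v -> I u v = I v u.

Definition edge_length (R : realType) (I : vertex -> vertex -> R)
    (r : vertex -> R) (u v : vertex) : R :=
  Num.sqrt (r u ^+ 2 + r v ^+ 2 + 2 * I u v * r u * r v).

(* As face is invariant under permutations, this covers the three triangle
   inequalities of each face. *)
Definition inversive_distance_packing (R : realType)
    (I : vertex -> vertex -> R) (r : vertex -> R) : Prop :=
  (forall v, 0 < r v) /\
  (forall u v w, face u v w ->
     edge_length I r u w < edge_length I r u v + edge_length I r v w).

Definition geometric_triangulation (R : realType)
    (I : vertex -> vertex -> R) (r : vertex -> R) : Prop :=
  exists phi : R * R -> R * R,
    [/\ injective phi,
        continuous phi,
        forall u v w, face u v w ->
          phi @` triangle (position R u) (position R v) (position R w) =
          triangle (phi (position R u)) (phi (position R v))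
                   (phi (position R w)) &
        forall u v, neighbor u v ->
          edist (phi (position R u)) (phi (position R v)) =
          edge_length I r u v].

(* Main.v *)
Require Import Defs.
From mathcomp Require Import all_boot all_order all_algebra.
From mathcomp Require Import all_classical all_reals all_analysis.
From mathcomp Require Import ring lra zify.

(** Idea. If r(v0) / r(vk) is huge then, by pigeonhole on the scales of the radii
    in a finite patch, a threshold splits the patch into big and tiny vertices,
    every tiny radius being at most e times every big one, with v0 big and vk
    tiny. Tiny vertices joined by tiny edges are drawn at nearly the same point,
    and a tiny vertex k sees two adjacent big vertices u, w under an angle with
    cosine close to -I(u, w) < 1/2, hence exceeding pi/3 by a fixed margin. Follow
    the border between the tiny component of vk and the big vertices, starting
    from the edge vk v0, and measure the angle, seen from the current tiny vertex,
    between the current big vertex and a fixed point q of the edge vk v0. Each new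
    big vertex adds more than pi/3 and tiny steps change little; but the angle
    cannot pass 2 pi before the walk closes up, as q would then lie in the
    interior of a drawn triangle or two edges would cross. So the walk closes up
    after fewer than six big steps, and then, by a finite inspection of the
    lattice, the big vertices met are enclosed by the tiny ones met. That
    contradicts the maximum principle: a vertex lies in the interior of the convex
    hull of its neighbours. *)

Set Implicit Arguments.
Unset Strict Implicit.
Unset Printing Implicit Defensive.

Import Order.TTheory GRing.Theory Num.Theory.
Import numFieldNormedType.Exports.

Local Open Scope classical_set_scope.
Local Open Scope ring_scope.

(** * Border walks in the lattice *)

Definition unit_steps : seq vertex :=
  [:: (1, 0); (-1, 0); (0, 1); (0, -1); (1, -1); (-1, 1)].

Definition vadd (u d : vertex) : vertex := (u.1 + d.1, u.2 + d.2).

(* Multiplication by exp (i pi / 3) and by its inverse. *)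
Definition vrot (d : vertex) : vertex := (- d.2, d.1 + d.2).
Definition vunrot (d : vertex) : vertex := (d.1 + d.2, - d.1).

(* A state (k, d) of the border walk is the edge from the tiny vertex k to the
   big vertex k + d; the next face counterclockwise around k has third vertex
   k + vrot d, which replaces k + d if it is big, and k if it is tiny. *)
Definition far_end (s : vertex * vertex) : vertex := vadd s.1 s.2.
Definition ahead (s : vertex * vertex) : vertex := vadd s.1 (vrot s.2).

Definition walk_step (big : pred vertex) (s : vertex * vertex) : vertex * vertex :=
  if big (ahead s) then (s.1, vrot s.2) else (ahead s, vunrot s.2).

Definition enclosed (W K : seq vertex) : bool :=
  all (fun w => all (fun d => (vadd w d \in W) || (vadd w d \in K)) unit_steps) W.

(* Explores all border walks from s0, the vertices being declared big or tiny as
   the walk meets them, until six turns have been made (c = 6) or the big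
   vertices W of a closed walk are enclosed by the tiny ones K. After t = 5
   consecutive slides a single big vertex may already be surrounded. *)
Fixpoint explore (fuel : nat) (s0 s : vertex * vertex) (c t : nat)
    (W K : seq vertex) : bool :=
  if c == 6 then true else
  if (W != [::]) && (s == s0) then enclosed W K else
  let W' := far_end s :: W in let K' := s.1 :: K in
  if (t == 5) && enclosed [:: far_end s] K' then true else
  if fuel is f.+1 then
    ((ahead s \in K') || explore f s0 (s.1, vrot s.2) c.+1 0 W' K') &&
    ((ahead s \in W') || explore f s0 (ahead s, vunrot s.2) c t.+1 W' K')
  else false.

(** Evaluation runs through every partial colouring that a walk of at most 22 steps can meet. A
    branch is cut as soon as it would give a vertex already met the other colour. *)
Lemma explore_start : explore 22 (0, (1, 0)) (0, (1, 0)) 0 0 [::] [::].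
Proof. by vm_compute. Qed.

Definition walk (big : pred vertex) (s : vertex * vertex) (n : nat) :=
  iter n (walk_step big) s.

Definition turns (big : pred vertex) (s : vertex * vertex) (n : nat) : nat :=
  \sum_(m < n) big (ahead (walk big s m)).

Lemma far_end_walk_step (big : pred vertex) (s : vertex * vertex) :
  far_end (walk_step big s) = if big (ahead s) then ahead s else far_end s.
Proof.
rewrite /walk_step /far_end /ahead; case: ifP => // _.
by rewrite /vadd /vrot /vunrot /=; congr pair; ring.
Qed.

Lemma walk_border (big : pred vertex) (s : vertex * vertex) (n : nat) :
  ~~ big s.1 -> big (far_end s) ->
  ~~ big (walk big s n).1 && big (far_end (walk big s n)).
Proof.
move=> h1 h2; elim: n => [|n /andP[ih1 ih2]]; first by rewrite /= h1.
rewrite /walk iterS -/(walk big s n) far_end_walk_step /walk_step.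
by case: ifP => [h|/negbT h]; rewrite ?h /= ?ih1 ?ih2.
Qed.

Lemma visited_cons (big : pred vertex) (s : vertex * vertex) (n : nat)
    (A : seq vertex) (f : vertex * vertex -> vertex) :
  {subset A <= [seq f (walk big s m) | m <- iota 0 n]} ->
  {subset f (walk big s n) :: A <= [seq f (walk big s m) | m <- iota 0 n.+1]}.
Proof.
move=> hA x; rewrite -addn1 iotaD map_cat mem_cat inE => /orP[/eqP ->|/hA -> //].
by rewrite add0n /= !inE eqxx orbT.
Qed.

(** Among the branches explored, the true walk of [big] follows exactly one, and the conclusion is
    read off where that branch stops. The hypotheses say that [W] and [K] hold only vertices already
    visited and that [W] is empty only at the start, where the test for a closed walk must not
    fire. *)
Lemma explore_sound (big : pred vertex) (s0 : vertex * vertex) (fuel n t : nat)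
    (W K : seq vertex) :
  ~~ big s0.1 -> big (far_end s0) ->
  explore fuel s0 (walk big s0 n) (turns big s0 n) t W K ->
  {subset W <= [seq far_end (walk big s0 m) | m <- iota 0 n]} ->
  {subset K <= [seq (walk big s0 m).1 | m <- iota 0 n]} ->
  (W == [::]) = (n == 0) ->
  (forall m, (0 < m < n)%N -> walk big s0 m != s0) ->
  exists2 N, (N <= n + fuel)%N &
    (turns big s0 N = 6 /\ forall m, (0 < m < N)%N -> walk big s0 m != s0) \/
    exists W' K' : seq vertex,
      [/\ W' != [::],
          {subset W' <= [seq far_end (walk big s0 m) | m <- iota 0 N.+1]},
          {subset K' <= [seq (walk big s0 m).1 | m <- iota 0 N.+1]} &
          enclosed W' K'].
Proof.
move=> hk hw; elim: fuel n t W K => [|fuel IH] n t W K;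
  rewrite [explore _ _ _ _ _ _ _]/= -/(far_end _).
all: case: eqP => [h6 _ _ _ _ hs|_]; first by exists n; [rewrite leq_addr | left].
all: have sub := @visited_cons big s0 n.
all: case: ifP => [/andP[Wn _] hc hW hK _ _|hst].
1,3: exists n; [by rewrite leq_addr | right; exists W, K; split=> // x].
1-4: by rewrite -addn1 iotaD map_cat mem_cat => h; rewrite ?hW ?hK.
all: case: ifP => [/andP[_ hc] hh hW hK _ _|_]; first (exists n;
  [by rewrite leq_addr | right; exists [:: far_end (walk big s0 n)],
    ((walk big s0 n).1 :: K); split=> //; [exact: sub | exact: (sub _ fst)]]).
all: try by [].
move=> /andP[hB hT] hW hK hn hs.
have hs' m : (0 < m < n.+1)%N -> walk big s0 m != s0.
  rewrite ltnS [(m <= n)%N]leq_eqVlt => /andP[m0 /orP[/eqP mn|mn]]; last first.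
    by apply: hs; rewrite m0.
  move: m0 hst; rewrite mn hn => n0.
  by rewrite -lt0n n0 /= => /negbT.
have /andP[tk bw] := walk_border n hk hw.
(* Recorded vertices have the colour that [big] gives them, so the branch chosen by [big] is never
   one of those cut. *)
have bW x : x \in far_end (walk big s0 n) :: W -> big x.
  move=> /(sub _ _ hW) /mapP[m _ ->].
  by have /andP[] := walk_border m hk hw.
have bK x : x \in (walk big s0 n).1 :: K -> ~~ big x.
  move=> /(sub _ fst hK) /mapP[m _ ->].
  by have /andP[] := walk_border m hk hw.
have e1 : walk big s0 n.+1 = walk_step big (walk big s0 n) by [].
have e2 : turns big s0 n.+1 = (turns big s0 n + big (ahead (walk big s0 n)))%N.
  by rewrite /turns big_ord_recr.
rewrite -addSnnS.
have [bx|tx] := boolP (big (ahead (walk big s0 n))).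
  have {hT}hB : explore fuel s0 (walk big s0 n.+1) (turns big s0 n.+1) 0
      (far_end (walk big s0 n) :: W) ((walk big s0 n).1 :: K).
    rewrite e1 e2 /walk_step bx addn1; case/orP: hB => // /bK.
    by rewrite bx.
  apply: IH hB _ _ _ hs' => //; first exact: sub.
  exact: (sub _ fst).
have {hB}hT : explore fuel s0 (walk big s0 n.+1) (turns big s0 n.+1) t.+1
      (far_end (walk big s0 n) :: W) ((walk big s0 n).1 :: K).
  rewrite e1 e2 /walk_step (negbTE tx) addn0; case/orP: hT => // /bW.
  by rewrite (negbTE tx).
apply: IH hT _ _ _ hs' => //; first exact: sub.
exact: (sub _ fst).
Qed.

(** Both outcomes are refuted geometrically later: six turns before a return sweep too large an
    angle, and an enclosed set violates the maximum principle. *)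
Lemma border_dichotomy (big : pred vertex) :
  let s0 : vertex * vertex := (0, (1, 0)) in
  ~~ big 0 -> big (1, 0) ->
  exists2 N, (N <= 22)%N &
    (turns big s0 N = 6 /\ forall m, (0 < m < N)%N -> walk big s0 m != s0) \/
    exists W K : seq vertex,
      [/\ W != [::],
          {subset W <= [seq far_end (walk big s0 m) | m <- iota 0 N.+1]},
          {subset K <= [seq (walk big s0 m).1 | m <- iota 0 N.+1]} &
          enclosed W K].
Proof.
move=> s0 h0 h1; apply: (@explore_sound big s0 22 0 0 [::] [::]) => //.
- by rewrite /turns big_ord0; exact: explore_start.
- by move=> m; rewrite ltn0 andbF.
Qed.

(** * Angles in the plane *)

Definition vec (R : realType) (a b : R * R) : R * R := (b.1 - a.1, b.2 - a.2).
Definition dot (R : realType) (u v : R * R) : R := u.1 * v.1 + u.2 * v.2.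
Definition cross (R : realType) (u v : R * R) : R := u.1 * v.2 - u.2 * v.1.
Definition len (R : realType) (u : R * R) : R := Num.sqrt (u.1 ^+ 2 + u.2 ^+ 2).
Definition orient (R : realType) (a b c : R * R) : R :=
  cross (vec a b) (vec a c).

(** The angle is any real lift, not reduced modulo 2 pi, so that it can accumulate along a walk. *)
Definition has_angle (R : realType) (u : R * R) (alpha : R) : Prop :=
  u.1 = len u * cos alpha /\ u.2 = len u * sin alpha.

Lemma len_ge0 (R : realType) (u : R * R) : 0 <= len u.
Proof. exact: sqrtr_ge0. Qed.

Lemma len_sqr (R : realType) (u : R * R) : len u ^+ 2 = u.1 ^+ 2 + u.2 ^+ 2.
Proof. by rewrite sqr_sqrtr // addr_ge0 // sqr_ge0. Qed.

Lemma len_vecC (R : realType) (a b : R * R) : len (vec a b) = len (vec b a).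
Proof. by rewrite /len /=; congr Num.sqrt; ring. Qed.

Lemma ler_of_sqr (R : realType) (x y : R) : 0 <= y -> x ^+ 2 <= y ^+ 2 -> x <= y.
Proof.
move=> y0 h; have [x0|x0] := ltP x 0; first exact: le_trans (ltW x0) y0.
by rewrite -(ler_pXn2r (_ : (0 < 2)%N)) // nnegrE.
Qed.

Lemma dot_cross_len (R : realType) (u v : R * R) :
  dot u v ^+ 2 + cross u v ^+ 2 = (len u * len v) ^+ 2.
Proof. by rewrite exprMn !len_sqr /dot /cross; ring. Qed.

Lemma dot_le_len (R : realType) (u v : R * R) : dot u v <= len u * len v.
Proof.
apply: ler_of_sqr; first by rewrite mulr_ge0 ?len_ge0.
by rewrite -dot_cross_len lerDl sqr_ge0.
Qed.

Lemma len_triangle (R : realType) (a b c : R * R) :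
  len (vec a c) <= len (vec a b) + len (vec b c).
Proof.
apply: ler_of_sqr; first by rewrite addr_ge0 ?len_ge0.
rewrite sqrrD !len_sqr; have := dot_le_len (vec a b) (vec b c).
rewrite /dot /=; nra.
Qed.

Lemma len_vec_eq0 (R : realType) (a b : R * R) : len (vec a b) = 0 -> a = b.
Proof.
move=> h; have := len_sqr (vec a b); rewrite h /= => e.
have h1 : (b.1 - a.1) ^+ 2 = 0 by have := sqr_ge0 (b.1 - a.1);
  have := sqr_ge0 (b.2 - a.2); lra.
have h2 : (b.2 - a.2) ^+ 2 = 0 by lra.
move/eqP: h1; rewrite sqrf_eq0 subr_eq0 => /eqP h1.
move/eqP: h2; rewrite sqrf_eq0 subr_eq0 => /eqP h2.
by rewrite [a]surjective_pairing [b]surjective_pairing h1 h2.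
Qed.

Lemma angle_dot (R : realType) (u v : R * R) (a b : R) :
  has_angle u a -> has_angle v b -> dot u v = len u * len v * cos (b - a).
Proof. by move=> [u1 u2] [v1 v2]; rewrite /dot u1 u2 v1 v2 cosB; ring. Qed.

Lemma angle_cross (R : realType) (u v : R * R) (a b : R) :
  has_angle u a -> has_angle v b -> cross u v = len u * len v * sin (b - a).
Proof. by move=> [u1 u2] [v1 v2]; rewrite /cross u1 u2 v1 v2 sinB; ring. Qed.

(** The signed angle from u to v is the arc cosine of the normalized dot product, with the sign of
    the cross product. *)
Lemma angle_turn (R : realType) (u v : R * R) (a : R) :
  0 < len u -> 0 < len v -> has_angle u a ->
  exists g : R, [/\ - pi <= g <= pi, has_angle v (a + g),
    cos g = dot u v / (len u * len v) & 0 <= cross u v -> 0 <= g].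
Proof.
move=> u0 v0 [u1 u2].
set c := dot u v / (len u * len v); set s := cross u v / (len u * len v).
have n0 : len u * len v != 0 by rewrite mulf_neq0 ?gt_eqF.
have cs : c ^+ 2 + s ^+ 2 = 1.
  rewrite /c /s !expr_div_n -mulrDl dot_cross_len divff //.
  by rewrite expf_neq0.
have c1 : -1 <= c <= 1.
  have s2 := sqr_ge0 s.
  rewrite -ler_norml; apply: ler_of_sqr => //.
  by rewrite real_normK ?num_real //; lra.
have main g : cos g = c -> sin g = s -> has_angle v (a + g).
  move=> hc hs; have lu := len_sqr u.
  have d0 : len u != 0 by rewrite gt_eqF.
  have d1 : len v != 0 by rewrite gt_eqF.
  have ca : cos a = u.1 / len u by rewrite u1; field.
  have sa : sin a = u.2 / len u by rewrite u2; field.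
  by split; rewrite ?cosD ?sinD hc hs ca sa /c /s /dot /cross;
    apply: (mulfI (expf_neq0 2 d0)); rewrite {1}lu; field; rewrite ?d0 ?d1.
have [s0|s0] := leP 0 s.
  exists (acos c); rewrite acosK ?in_itv //=; split=> //.
  - by have := acos_ge0 c1; have := acos_lepi c1; have := pi_gt0 R; lra.
  - apply: main; first by rewrite acosK ?in_itv.
    rewrite sin_acos // -[s in RHS]ger0_norm // -sqrtr_sqr; congr Num.sqrt; lra.
  - by rewrite acos_ge0.
exists (- acos c); rewrite cosN acosK ?in_itv //=; split=> //.
- by have := acos_ge0 c1; have := acos_lepi c1; have := pi_gt0 R; lra.
- apply: main; first by rewrite cosN acosK ?in_itv.
  rewrite sinN sin_acos // -[s in RHS]opprK; congr (- _).
  rewrite -[RHS]ger0_norm ?oppr_ge0 1?ltW // -sqrtr_sqr; congr Num.sqrt.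
  rewrite sqrrN; lra.
- by move=> h; move: s0; rewrite ltNge /s divr_ge0 // mulr_ge0 // ltW.
Qed.

Lemma exists_angle (R : realType) (u : R * R) :
  0 < len u -> exists a, has_angle u a.
Proof.
move=> u0; have h : len ((1, 0) : R * R) = 1.
  by rewrite /len /= expr1n expr0n /= addr0 sqrtr1.
have [] := @angle_turn R (1, 0) u 0.
- by rewrite h.
- by [].
- by rewrite /has_angle h cos0 sin0 /=; split; ring.
by move=> g [_ hg _ _]; exists (0 + g).
Qed.

(** If v differs from u by at most kappa times the length of u, the cosine of the angle between them
    is at least 1 - kappa. *)
Lemma small_turn (R : realType) (eta : R) : 0 < eta ->
  exists2 kappa : R, 0 < kappa & forall u v : R * R,
    0 < len u -> len (vec u v) <= kappa * len u -> forall a, has_angle u a ->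
    exists2 b, `|b| <= eta & has_angle v (a + b).
Proof.
move=> eta0; pose e := Num.min eta (pi / 2) : R.
have pi0 := pi_gt0 R.
have e0 : 0 < e by rewrite lt_min eta0 divr_gt0.
have epi : e <= pi by rewrite ge_min; apply/orP; right; lra.
have ce : cos e < 1.
  rewrite -(cos0 R) ltr_cos // ?in_itv /=; apply/andP; split; lra.
(* The bound 1/2 keeps v away from 0; the bound 1 - cos e is the one that controls the angle. *)
pose kappa := Num.min (1 / 2) (1 - cos e) : R.
have k0 : 0 < kappa by rewrite lt_min subr_gt0 ce andbT; lra.
have k1 : kappa <= 1 / 2 by rewrite ge_min lexx.
have k2 : kappa <= 1 - cos e by rewrite ge_min lexx orbT.
exists kappa => // u v u0 huv a ha.
have v0 : 0 < len v.
  rewrite lt_neqAle len_ge0 andbT; apply/eqP => v0.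
  have lu := len_sqr u; have lv := len_sqr v; have luv := len_sqr (vec u v).
  have : len (vec u v) ^+ 2 <= (1 / 2 * len u) ^+ 2.
    rewrite ler_pXn2r ?nnegrE ?len_ge0 ?mulr_ge0 //; try lra.
    by apply: le_trans huv _; rewrite ler_pM2r.
  rewrite luv exprMn lu /=; move: lv; rewrite -v0 => lv.
  have := sqr_ge0 v.1; have := sqr_ge0 v.2 => h1 h2.
  have v1 : v.1 = 0 by apply/eqP; rewrite -sqrf_eq0; apply/eqP; lra.
  have v2 : v.2 = 0 by apply/eqP; rewrite -sqrf_eq0; apply/eqP; lra.
  by rewrite v1 v2; have := exprn_gt0 2 u0; rewrite lu; lra.
have [g [gpi hg cg _]] := angle_turn u0 v0 ha.
exists g => //; apply: le_trans (_ : e <= _); last by rewrite ge_min lexx.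
rewrite leNgt; apply/negP => eg.
have : cos `|g| < cos e.
  by rewrite ltr_cos // in_itv /= ?(ltW e0) ?epi // normr_ge0 ler_norml.
have -> : cos `|g| = cos g by case: (ler0P g) => _; rewrite ?cosN.
rewrite cg ltr_pdivrMr ?mulr_gt0 //.
have : len (vec u v) ^+ 2 <= (kappa * len u) ^+ 2.
  by rewrite ler_pXn2r ?nnegrE ?len_ge0 ?mulr_ge0 // ltW.
rewrite len_sqr exprMn /=.
have -> : (v.1 - u.1) ^+ 2 + (v.2 - u.2) ^+ 2 = len u ^+ 2 + len v ^+ 2 - 2 * dot u v.
  by rewrite !len_sqr /dot; ring.
have kk : kappa ^+ 2 <= kappa by nra.
have : 2 * (len u * len v) <= len u ^+ 2 + len v ^+ 2.
  by have := sqr_ge0 (len u - len v); nra.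
set p := len u * len v; have p0 : 0 < p by rewrite mulr_gt0.
set A := len u ^+ 2; set B := len v ^+ 2.
have A0 : 0 <= A by rewrite sqr_ge0.
have B0 : 0 <= B by rewrite sqr_ge0.
set d := dot u v; move=> h1 h2 h3.
(* From A + B - 2 d <= kappa^2 A <= kappa A and 2 p <= A + B. *)
have : (1 - kappa) * p <= d by nra.
nra.
Qed.

(** * Drawings of the triangular lattice *)

Definition lerp (R : realType) (a b : R * R) (t : R) : R * R :=
  (a.1 + t * (b.1 - a.1), a.2 + t * (b.2 - a.2)).

Definition on_segment (R : realType) (a b z : R * R) : Prop :=
  exists2 t, 0 <= t <= 1 & z = lerp a b t.

(** The planarity used by the angle argument, free of any continuous map and hence easy to reflect
    and to relabel. The last clause describes the open face by the signs of [orient]. *)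
Definition hex_drawing (R : realType) (P : vertex -> R * R) : Prop :=
  [/\ forall k d : vertex, d \in unit_steps ->
        0 < orient (P k) (P (vadd k d)) (P (vadd k (vrot d))),
      forall (a b c d : vertex) z, neighbor a b -> neighbor c d ->
        on_segment (P a) (P b) z -> on_segment (P c) (P d) z ->
        (a = c /\ b = d \/ a = d /\ b = c) \/
        exists2 v : vertex, z = P v & (v \in [:: a; b]) && (v \in [:: c; d]) &
      forall (a b k d : vertex) z, neighbor a b -> d \in unit_steps ->
        on_segment (P a) (P b) z ->
        0 < orient (P k) (P (vadd k d)) z ->
        0 < orient (P (vadd k d)) (P (vadd k (vrot d))) z ->
        0 < orient (P (vadd k (vrot d))) (P k) z -> False].

Lemma on_segment_start (R : realType) (a c : R * R) : on_segment a c a.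
Proof.
exists 0; first by rewrite lexx ler01.
by rewrite /lerp !mul0r !addr0; case: a.
Qed.

Lemma lerp_lerp (R : realType) (a b : R * R) (s t c : R) :
  lerp (lerp a b s) (lerp a b t) c = lerp a b (s + c * (t - s)).
Proof. by rewrite /lerp /=; congr pair; ring. Qed.

Lemma on_segment_lerp (R : realType) (a b x y : R * R) (t : R) :
  on_segment a b x -> on_segment a b y -> 0 <= t <= 1 ->
  on_segment a b (lerp x y t).
Proof.
move=> [s s1 ->] [r r1 ->] t1; rewrite lerp_lerp.
by exists (s + t * (r - s)) => //; apply/andP; split; nra.
Qed.

Lemma on_segmentC (R : realType) (a b z : R * R) :
  on_segment a b z -> on_segment b a z.
Proof.
move=> [t t1 ->]; exists (1 - t); first lra.
by rewrite /lerp; congr pair; ring.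
Qed.

Lemma on_segment_end (R : realType) (a c : R * R) : on_segment a c c.
Proof. by apply: on_segmentC; exact: on_segment_start. Qed.

Lemma orient_lerp (R : realType) (a b x y : R * R) (t : R) :
  orient a b (lerp x y t) = (1 - t) * orient a b x + t * orient a b y.
Proof. by rewrite /orient /cross /vec /=; ring. Qed.

Lemma orient_rot (R : realType) (a b c : R * R) : orient a b c = orient b c a.
Proof. by rewrite /orient /cross /vec /=; ring. Qed.

Lemma orient_sum (R : realType) (a b c z : R * R) :
  orient a b z + orient b c z + orient c a z = orient a b c.
Proof. by rewrite /orient /cross /vec /=; ring. Qed.

Lemma len_lerp (R : realType) (o x y : R * R) (t : R) : 0 <= t <= 1 ->
  len (vec o (lerp x y t)) <= (1 - t) * len (vec o x) + t * len (vec o y).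
Proof.
move=> t1; have := len_ge0 (vec o x); have := len_ge0 (vec o y) => y0 x0.
apply: ler_of_sqr; first by nra.
have hd := dot_le_len (vec o x) (vec o y).
have hx := len_sqr (vec o x); have hy := len_sqr (vec o y).
have -> : len (vec o (lerp x y t)) ^+ 2 = (1 - t) ^+ 2 * len (vec o x) ^+ 2 +
    t ^+ 2 * len (vec o y) ^+ 2 + 2 * (t * (1 - t)) * dot (vec o x) (vec o y).
  by rewrite !len_sqr /dot /vec /=; ring.
have t2 : 0 <= t * (1 - t) by nra.
nra.
Qed.

(** Two affine functions on [0, 1] are both positive at 1, and f is not positive at 0. Stop at the
    zero of f; if g is negative there, go on to the zero of g, where f has become nonnegative. *)
Lemma affine_exit (R : realType) (fx fy gx gy : R) :
  0 < fy -> 0 < gy -> fx <= 0 ->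
  exists t, [/\ 0 <= t, t < 1 &
    ((1 - t) * fx + t * fy = 0 /\ 0 <= (1 - t) * gx + t * gy) \/
    ((1 - t) * gx + t * gy = 0 /\ 0 <= (1 - t) * fx + t * fy)].
Proof.
move=> fy0 gy0 fx0; pose t := - fx / (fy - fx).
have d0 : 0 < fy - fx by lra.
have t0 : 0 <= t by rewrite divr_ge0 //; lra.
have t1 : t < 1 by rewrite ltr_pdivrMr //; lra.
have ft : (1 - t) * fx + t * fy = 0 by rewrite /t; field; rewrite gt_eqF.
have [g0|g0] := leP 0 ((1 - t) * gx + t * gy); first by exists t; split=> //; left.
set g := _ + _ in g0; pose s := - g / (gy - g).
have e0 : 0 < gy - g by lra.
have s0 : 0 <= s by rewrite divr_ge0 //; lra.
have s1 : s < 1 by rewrite ltr_pdivrMr //; lra.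
have gs : (1 - s) * g + s * gy = 0 by rewrite /s; field; rewrite gt_eqF.
exists (t + s * (1 - t)); split; [by nra | by nra | right; split].
  rewrite -[RHS]gs; have : g = (1 - t) * gx + t * gy by [].
  by move: g s {g0 e0 s0 s1 gs} => g s ->; ring.
have -> : (1 - (t + s * (1 - t))) * fx + (t + s * (1 - t)) * fy =
    (1 - s) * ((1 - t) * fx + t * fy) + s * fy by ring.
by rewrite ft mulr0 add0r mulr_ge0 // ltW.
Qed.

(** The coordinates of a point in the frame (u - p, w - p) are quotients of orientations, affine
    along the segment from x to y. [affine_exit] finds a point where one vanishes and the other is
    nonnegative, that is, a point of a bounding ray. *)
Lemma cone_exit (R : realType) (p u w x y : R * R) :
  0 < orient p u w -> ~ (0 < orient p u x /\ 0 < orient p x w) ->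
  0 < orient p u y -> 0 < orient p y w ->
  exists t, [/\ 0 <= t, t < 1 & exists2 l, 0 <= l &
    lerp x y t = lerp p u l \/ lerp x y t = lerp p w l].
Proof.
move=> D0 hx fy gy.
have og z : orient p z w = orient w p z by rewrite -orient_rot.
(* Cramer's rule in the basis u - p, w - p. *)
have key z : z = (p.1 + (orient p z w * (u.1 - p.1) + orient p u z * (w.1 - p.1)) / orient p u w,
                  p.2 + (orient p z w * (u.2 - p.2) + orient p u z * (w.2 - p.2)) / orient p u w).
  rewrite [LHS]surjective_pairing; congr pair; apply: (mulIf (lt0r_neq0 D0));
  by rewrite mulrDl divfK ?(lt0r_neq0 D0) // /orient /cross /vec /=; ring.
have fin t : 0 <= t -> t < 1 ->
    (orient p u (lerp x y t) = 0 /\ 0 <= orient p (lerp x y t) w) \/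
    (orient p (lerp x y t) w = 0 /\ 0 <= orient p u (lerp x y t)) ->
    exists t, [/\ 0 <= t, t < 1 & exists2 l, 0 <= l &
    lerp x y t = lerp p u l \/ lerp x y t = lerp p w l].
  move=> t0 t1 h; exists t; split=> //.
  have := key (lerp x y t); case: h => -[e1 e2]; rewrite e1.
    exists (orient p (lerp x y t) w / orient p u w); first by rewrite divr_ge0 // ltW.
    by left; rewrite [LHS]H /lerp; congr pair; rewrite mul0r addr0; ring.
  exists (orient p u (lerp x y t) / orient p u w); first by rewrite divr_ge0 // ltW.
  by right; rewrite [LHS]H /lerp; congr pair; rewrite mul0r add0r; ring.
have [fx|fx] := leP (orient p u x) 0.
  have [t [t0 t1 h]] := @affine_exit R _ _ (orient w p x) (orient w p y) fy
    (eq_ind _ (fun r => 0 < r) gy _ (og y)) fx.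
  by apply: (fin t t0 t1); rewrite og !orient_lerp.
have [gx|gx] := leP (orient p x w) 0; last by case: hx.
rewrite (og x) in gx; rewrite (og y) in gy; have [t [t0 t1 h]] := @affine_exit R _ _ (orient p u x) _ gy fy gx.
apply: (fin t t0 t1); rewrite og !orient_lerp.
by case: h => h; [right|left].
Qed.

Lemma neighborC (a b : vertex) : neighbor a b = neighbor b a.
Proof.
rewrite /neighbor !inE !xpair_eqE /=.
by apply/idP/idP => h; lia.
Qed.

Lemma neighbor_vadd (k d : vertex) : neighbor k (vadd k d) = (d \in unit_steps).
Proof.
by rewrite /neighbor /vadd /= [k.1 + _]addrC [k.2 + _]addrC !addrK; case: d.
Qed.

Lemma vrot_unit (d : vertex) : d \in unit_steps -> vrot d \in unit_steps.
Proof. by rewrite !inE => /orP[/eqP->|/orP[/eqP->|/orP[/eqP->|/orP[/eqP->|/orP[/eqP->|/eqP->]]]]]. Qed.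

Lemma vunrot_unit (d : vertex) : d \in unit_steps -> vunrot d \in unit_steps.
Proof. by rewrite !inE => /orP[/eqP->|/orP[/eqP->|/orP[/eqP->|/orP[/eqP->|/orP[/eqP->|/eqP->]]]]]. Qed.

Lemma vadd_vrot_vunrot (k d : vertex) : vadd (vadd k (vrot d)) (vunrot d) = vadd k d.
Proof. by rewrite /vadd /vrot /vunrot /=; congr pair; ring. Qed.

Definition in_cone (R : realType) (p u w z : R * R) : Prop :=
  0 < orient p u z /\ 0 < orient p z w.

Lemma orient_self (R : realType) (a b : R * R) (t : R) : orient a b (lerp a b t) = 0.
Proof. by rewrite /orient /cross /vec /=; ring. Qed.

Lemma orient_self' (R : realType) (a b : R * R) (t : R) : orient a (lerp a b t) b = 0.
Proof. by rewrite /orient /cross /vec /=; ring. Qed.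

(* A segment entering the cone within the disc crosses one of the two edges
   bounding it, because their far ends lie outside of the disc. *)
Lemma no_entry (R : realType) (P : vertex -> R * R) (o : R * R) (rho : R)
    (k d a b : vertex) (x y : R * R) :
  hex_drawing P -> d \in unit_steps -> neighbor a b ->
  len (vec o (P k)) <= rho ->
  rho < len (vec o (P (vadd k d))) -> rho < len (vec o (P (vadd k (vrot d)))) ->
  on_segment (P a) (P b) x -> on_segment (P a) (P b) y ->
  len (vec o x) <= rho -> len (vec o y) <= rho ->
  ~ in_cone (P k) (P (vadd k d)) (P (vadd k (vrot d))) x ->
  ~ in_cone (P k) (P (vadd k d)) (P (vadd k (vrot d))) y.
Proof.
move=> [hO hE hF] hd hab nk fu fw sx sy nx ny cx [cy1 cy2].
have D0 := hO k d hd.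
have [t [t0 t1 [l l0 hz]]] := cone_exit D0 cx cy1 cy2.
have t01 : 0 <= t <= 1 by rewrite t0 ltW.
have sz := on_segment_lerp sx sy t01.
have nz : len (vec o (lerp x y t)) <= rho.
  by apply: le_trans (len_lerp o x y t01) _; nra.
(* If the segment passes through the apex, its points just after the apex towards y lie in the open
   face. The value of s keeps the orientation with respect to the third side at least half of its
   value at the apex. *)
have apex : lerp x y t = P k -> False.
  move=> ezk; set Q := orient (P (vadd k d)) (P (vadd k (vrot d))).
  have q0 : 0 < Q (P k) by rewrite /Q -orient_rot.
  pose s := Q (P k) / (2 * (Q (P k) + `|Q y|)).
  have n0 := normr_ge0 (Q y).
  have s0 : 0 < s by rewrite divr_gt0 // mulr_gt0 // ltr_wpDr.
  have s1 : s * (2 * (Q (P k) + `|Q y|)) = Q (P k) by rewrite divfK // gt_eqF // mulr_gt0 // ltr_wpDr.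
  have s2 : s <= 1 by nra.
  apply: (hF a b k d (lerp (P k) y s) hab hd).
  - by apply: on_segment_lerp; rewrite -?ezk // ltW.
  - by rewrite orient_lerp -(orient_self (P k) (P (vadd k d)) 0) in cy1 *;
       rewrite /orient /cross /vec /= in cy1 *; nra.
  - rewrite orient_lerp -/Q; have := ler_norm (- Q y); rewrite normrN => h.
    have : s * (- Q y) <= s * `|Q y| by rewrite ler_pM2l.
    nra.
  - rewrite orient_lerp; rewrite orient_rot in cy2.
    rewrite orient_rot in cy2.
    have -> : orient (P (vadd k (vrot d))) (P k) (P k) = 0.
      by rewrite /orient /cross /vec /=; ring.
    by rewrite mulr0 add0r mulr_gt0.
(* The crossing point lies before [P v] on the ray: otherwise [P v] would lie between two points of
   the disc. So two edges meet there, and they are either equal, which puts y on the boundary line,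
   or share the apex. *)
have ray v : neighbor k v -> lerp x y t = lerp (P k) (P v) l ->
    rho < len (vec o (P v)) ->
    (forall s, y <> lerp (P k) (P v) s) -> False.
  move=> nkv ez fv hy.
  have l1 : l < 1.
    rewrite ltNge; apply/negP => l1; have lp : 0 < l by lra.
    have ev : P v = lerp (P k) (lerp (P k) (P v) l) l^-1.
      by rewrite [LHS]surjective_pairing /lerp /=; congr pair; field; rewrite gt_eqF.
    have li : 0 <= l^-1 <= 1 by rewrite invr_ge0 ltW //= invf_le1.
    have := len_lerp o (P k) (lerp (P k) (P v) l) li.
    rewrite -ev -ez => h; have : len (vec o (P v)) <= rho by apply: le_trans h _; nra.
    by rewrite leNgt fv.
  have sz' : on_segment (P k) (P v) (lerp x y t).
    by exists l => //; rewrite l0 ltW.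
  have [same|[v' ev' /andP[_ v2]]] := hE _ _ _ _ _ hab nkv sz sz'.
    have : on_segment (P k) (P v) y.
      by case: same => [[<- <-]|[<- <-]] //; exact: on_segmentC.
    by move=> [s _ /hy].
  move: v2; rewrite !inE => /orP[/eqP e|/eqP e]; last first.
    by move: nz; rewrite ev' e leNgt fv.
  by apply: apex; rewrite ev' e.
case: hz => hz.
- apply: (ray (vadd k d)) => //; first by rewrite neighbor_vadd.
  by move=> s e; move: cy1; rewrite e orient_self ltxx.
- apply: (ray (vadd k (vrot d))) => //; first by rewrite neighbor_vadd vrot_unit.
  by move=> s e; move: cy2; rewrite e orient_self' ltxx.
Qed.

(** * Half-planes and the maximum principle *)

(** The difference of the two sides is len u ^ 2 times cross y z. *)
Lemma half_plane_turn (R : realType) (u y z : R * R) :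
  0 < len u -> 0 < cross y z ->
  cross u y * dot z u < dot y u * cross u z.
Proof.
move=> u0 c0; have := len_sqr u => lu.
have : 0 < len u ^+ 2 * cross y z by rewrite mulr_gt0 // exprn_gt0.
rewrite lu /cross /dot; nra.
Qed.

(** In an open half-plane the slope cross u y / dot y u strictly increases at each counterclockwise
    turn, so it cannot return to its first value after six turns. *)
Lemma half_plane_absurd (R : realType) (u y0 y1 y2 y3 y4 y5 : R * R) :
  0 < len u ->
  0 < cross y0 y1 -> 0 < cross y1 y2 -> 0 < cross y2 y3 ->
  0 < cross y3 y4 -> 0 < cross y4 y5 -> 0 < cross y5 y0 ->
  dot y0 u <= 0 -> dot y1 u <= 0 -> dot y2 u <= 0 ->
  dot y3 u <= 0 -> dot y4 u <= 0 -> dot y5 u <= 0 -> False.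
Proof.
move=> u0 c0 c1 c2 c3 c4 c5 h0 h1 h2 h3 h4 h5.
(* A vector on the boundary line cannot have both its predecessor and its successor in the closed
   half-plane, so all six lie in the open one. *)
have pos a b c : 0 < cross a b -> 0 < cross b c ->
    dot a u <= 0 -> dot b u <= 0 -> dot c u <= 0 -> dot b u < 0.
  move=> ab bc a0 b0 c00; rewrite lt_neqAle b0 andbT; apply/eqP => e.
  have := half_plane_turn u0 ab; have := half_plane_turn u0 bc.
  rewrite e => h h'; have sb : cross u b < 0 by nra.
  nra.
have turn a b : 0 < cross a b -> dot a u < 0 -> dot b u < 0 ->
    cross u a / dot a u < cross u b / dot b u.
  move=> ab a0 b0; have := half_plane_turn u0 ab => h.
  rewrite ltr_ndivrMr // mulrAC ltr_ndivrMr //; lra.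
have p0 := pos _ _ _ c5 c0 h5 h0 h1; have p1 := pos _ _ _ c0 c1 h0 h1 h2.
have p2 := pos _ _ _ c1 c2 h1 h2 h3; have p3 := pos _ _ _ c2 c3 h2 h3 h4.
have p4 := pos _ _ _ c3 c4 h3 h4 h5; have p5 := pos _ _ _ c4 c5 h4 h5 h0.
have := turn _ _ c0 p0 p1; have := turn _ _ c1 p1 p2; have := turn _ _ c2 p2 p3.
have := turn _ _ c3 p3 p4; have := turn _ _ c4 p4 p5; have := turn _ _ c5 p5 p0.
lra.
Qed.

Lemma seq_argmax (R : realType) (T : eqType) (f : T -> R) (s : seq T) :
  s != [::] -> exists2 x, x \in s & forall y, y \in s -> f y <= f x.
Proof.
elim: s => // x s IH _; have [->|/IH[y ys hy]] := eqVneq s [::].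
  by exists x; rewrite ?inE // => y; rewrite inE => /eqP ->.
have [xy|/ltW yx] := leP (f x) (f y).
  by exists y; rewrite ?inE ?ys ?orbT // => z; rewrite inE => /orP[/eqP ->|/hy].
exists x; rewrite ?inE ?eqxx // => z; rewrite inE => /orP[/eqP -> //|/hy h].
exact: le_trans h yx.
Qed.

(* Maximum principle: the vertex of W farthest from o would have all its
   neighbours in a half-plane. *)
Lemma enclosed_absurd (R : realType) (P : vertex -> R * R) (o : R * R) (rho : R)
    (W K : seq vertex) :
  hex_drawing P -> W != [::] -> enclosed W K ->
  (forall w, w \in W -> rho < len (vec o (P w))) ->
  (forall k, k \in K -> len (vec o (P k)) <= rho) -> False.
Proof.
move=> [hO _ _] W0 hWK fW nK.
have [w wW hw] := seq_argmax (fun v => len (vec o (P v))) W0.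
have near (d : vertex) : d \in unit_steps ->
    len (vec o (P (vadd w d))) <= len (vec o (P w)).
  move=> hd; have /allP/(_ _ hd)/orP[h|h] := allP hWK _ wW; first exact: hw.
  exact: le_trans (nK _ h) (ltW (fW _ wW)).
have neg (d : vertex) : d \in unit_steps ->
    dot (vec (P w) (P (vadd w d))) (vec o (P w)) <= 0.
  move=> hd; have h := near d hd.
  have : len (vec o (P (vadd w d))) ^+ 2 <= len (vec o (P w)) ^+ 2.
    by rewrite ler_pXn2r // nnegrE len_ge0.
  rewrite !len_sqr /dot /vec /=.
  have := sqr_ge0 ((P (vadd w d)).1 - (P w).1).
  have := sqr_ge0 ((P (vadd w d)).2 - (P w).2).
  lra.
have pos (d : vertex) : d \in unit_steps ->
  0 < cross (vec (P w) (P (vadd w d))) (vec (P w) (P (vadd w (vrot d)))).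
  exact: hO.
(* At maximal distance 0, w and a neighbour would both be drawn at o, which makes a face
   degenerate. *)
have u0 : 0 < len (vec o (P w)).
  rewrite lt_neqAle len_ge0 andbT; apply/eqP => /esym wo.
  have /len_vec_eq0 e1 : len (vec o (P (vadd w (1, 0)))) = 0.
    by apply/eqP; rewrite eq_le len_ge0 andbT -wo near.
  have := pos (1, 0) isT; rewrite -e1 -(len_vec_eq0 wo) /cross /vec /= !subrr.
  by rewrite !mul0r subrr ltxx.
by apply: (half_plane_absurd u0 (pos (1, 0) isT) (pos (0, 1) isT)
  (pos (-1, 1) isT) (pos (-1, 0) isT) (pos (0, -1) isT) (pos (1, -1) isT)); exact: neg.
Qed.

(** * The angle along the border *)

(** Since cos (2 pi / 3) = - cos (pi / 3), the duplication formula gives 2 c^2 + c - 1 = 0, whose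
    only positive root is 1/2. *)
Lemma cos_pi3 (R : realType) : cos (pi / 3 : R) = 1 / 2.
Proof.
have pi0 := pi_gt0 R.
have c0 : 0 < cos (pi / 3 : R) by apply: cos_gt0_pihalf; apply/andP; split; lra.
have e1 : cos (pi / 3 *+ 2) = - cos (pi / 3 : R).
  by rewrite (_ : pi / 3 *+ 2 = - (pi / 3) + pi); [rewrite cosDpi cosN | field].
rewrite cos_mulr2n in e1; nra.
Qed.

Lemma ge_angle (R : realType) (x y : R) :
  0 <= x <= pi -> 0 <= y <= pi -> cos y <= cos x -> x <= y.
Proof.
by move=> hx hy; rewrite leNgt => h; rewrite leNgt -ltr_cos ?in_itv.
Qed.

Lemma angle_lerp (R : realType) (p u : R * R) (t a : R) : 0 <= t ->
  has_angle (vec p u) a -> has_angle (vec p (lerp p u t)) a.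
Proof.
move=> t0 [h1 h2].
have -> : vec p (lerp p u t) = (t * (vec p u).1, t * (vec p u).2).
  by rewrite /vec /lerp /=; congr pair; ring.
have e : len (t * (vec p u).1, t * (vec p u).2) = t * len (vec p u).
  rewrite /len !exprMn -mulrDr sqrtrM ?sqr_ge0 // sqrtr_sqr ger0_norm //.
by rewrite /has_angle e /= -!mulrA -h1 -h2.
Qed.

Lemma len_vec_lerp (R : realType) (p u : R * R) (t : R) : 0 <= t ->
  len (vec p (lerp p u t)) = t * len (vec p u).
Proof.
move=> t0; rewrite /len /= ![_ + _ * _ - _]addrAC !subrr !add0r !exprMn -mulrDr.
by rewrite sqrtrM ?sqr_ge0 // sqrtr_sqr ger0_norm.
Qed.

Lemma same_angle_lerp (R : realType) (p u q : R * R) (a : R) :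
  0 < len (vec p u) -> has_angle (vec p u) a -> has_angle (vec p q) a ->
  q = lerp p u (len (vec p q) / len (vec p u)).
Proof.
move=> u0 [h1 h2] [k1 k2]; rewrite [LHS]surjective_pairing /lerp.
have n0 : len (vec p u) != 0 by rewrite gt_eqF.
move: h1 h2 k1 k2; rewrite [(vec p u).1]/= [(vec p u).2]/= [(vec p q).1]/= [(vec p q).2]/=.
set l := len (vec p q) => -> -> k1 k2.
by congr pair; rewrite mulrA divfK //; lra.
Qed.

Lemma has_angleD2pi (R : realType) (u : R * R) (a : R) :
  has_angle u a -> has_angle u (a + pi *+ 2).
Proof. by rewrite /has_angle sinD2pi cosD2pi. Qed.

(** The two length conditions keep the marker q away from both ends of its edge, and two distinct
    edges meet only at a common end. *)
Lemma marker_edge (R : realType) (P : vertex -> R * R) (s : R) (a c : vertex) :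
  let q := lerp (P 0) (P (1, 0)) s in
  hex_drawing P -> 0 < s < 1 -> 0 < len (vec (P 0) q) ->
  len (vec (P 0) q) < len (vec (P 0) (P (1, 0))) ->
  neighbor a c -> on_segment (P a) (P c) q ->
  (a = 0 /\ c = (1, 0)) \/ (a = (1, 0) /\ c = 0).
Proof.
move=> q [_ hE _] s01 q0 q1 nac sac.
have sq : on_segment (P 0) (P (1, 0)) q.
  by exists s => //; case/andP: s01 => h1 h2; rewrite !ltW.
have n01 : neighbor 0 (1, 0) by [].
have [same|[v e /andP[_ hv]]] := hE _ _ _ _ _ nac n01 sac sq.
  by case: same; [left|right].
move: hv q0 q1; rewrite !inE => /orP[] /eqP ev; rewrite e ev ?ltxx //.
have -> : vec (P 0) (P 0) = (0 * 1, 0 * 1) :> R * R by rewrite /vec !mul0r !subrr.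
by rewrite /len /= !mul0r expr0n /= addr0 sqrtr0 ltxx.
Qed.

(** Passing 2 pi during a turn would sweep over the direction of q, placing q in the open cone of
    the turn. Reaching 2 pi exactly puts q on the new edge, which must then be the marked one, so
    the walk is back at its start. *)
Lemma turn_step (R : realType) (P : vertex -> R * R) (s : R) (k d : vertex)
    (alpha beta g : R) :
  let q := lerp (P 0) (P (1, 0)) s in
  let w := vadd k d in let w' := vadd k (vrot d) in
  hex_drawing P -> 0 < s < 1 -> 0 < len (vec (P 0) q) ->
  len (vec (P 0) q) < len (vec (P 0) (P (1, 0))) ->
  d \in unit_steps -> k != (1, 0) ->
  0 < len (vec (P k) (P w)) -> 0 < len (vec (P k) q) ->
  len (vec (P k) q) <= len (vec (P k) (P w')) ->
  ~ in_cone (P k) (P w) (P w') q ->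
  has_angle (vec (P k) (P w)) alpha -> has_angle (vec (P k) q) beta ->
  has_angle (vec (P k) (P w')) (alpha + g) -> g <= pi ->
  alpha - beta < pi *+ 2 ->
  alpha + g - beta <= pi *+ 2 /\
  (alpha + g - beta < pi *+ 2 \/ k = 0 /\ w' = (1, 0)).
Proof.
move=> q w w' hP s01 q0 q1 hd k1 w0 kq0 kqw nc ha hb hg gpi lt2.
have w'0 : 0 < len (vec (P k) (P w')) by exact: lt_le_trans kq0 kqw.
have c1 : orient (P k) (P w) q =
    len (vec (P k) (P w)) * len (vec (P k) q) * sin (pi *+ 2 - (alpha - beta)).
  by rewrite /orient (angle_cross ha hb) -sinD2pi; congr (_ * sin _); ring.
have c2 : orient (P k) q (P w') =
    len (vec (P k) q) * len (vec (P k) (P w')) * sin (alpha + g - beta - pi *+ 2).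
  by rewrite /orient (angle_cross hb hg) -[in RHS]sinD2pi; congr (_ * sin _); ring.
have le2 : alpha + g - beta <= pi *+ 2.
  rewrite leNgt; apply/negP => gt2; apply: nc; split; rewrite ?c1 ?c2.
  - by rewrite !mulr_gt0 // sin_gt0_pi //; apply/andP; split; lra.
  - by rewrite !mulr_gt0 // sin_gt0_pi //; apply/andP; split; lra.
split=> //; have [?|ge2] := ltP (alpha + g - beta) (pi *+ 2); first by left.
right; have e : alpha + g = beta + pi *+ 2.
  by have := le_anti (introT andP (conj le2 ge2)) => h; lra.
rewrite e in hg; have hq := same_angle_lerp w'0 hg (has_angleD2pi hb).
have sq : on_segment (P k) (P w') q.
  rewrite hq; exists (len (vec (P k) q) / len (vec (P k) (P w'))) => //.
  by rewrite divr_ge0 ?len_ge0 // ler_pdivrMr // mul1r.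
have nk : neighbor k w' by rewrite neighbor_vadd vrot_unit.
have [//|[e1 _]] := marker_edge hP s01 q0 q1 nk sq.
by rewrite e1 eqxx in k1.
Qed.

Lemma on_segment_side (R : realType) (k w x q : R * R) :
  0 < orient k w x -> orient w x q = 0 -> 0 <= orient x k q ->
  0 <= orient k w q -> on_segment x w q.
Proof.
move=> D0 A1 C0 B0; have hsum := orient_sum k w x q.
exists (orient x k q / orient k w x).
  apply/andP; split; first by rewrite divr_ge0 // ltW.
  by rewrite ler_pdivrMr // mul1r -hsum A1; lra.
rewrite [LHS]surjective_pairing /lerp; congr pair;
  apply: (mulIf (lt0r_neq0 D0)); rewrite mulrDl [X in _ + X]mulrAC divfK ?(lt0r_neq0 D0) //.
- have : orient w x q * (k.1 - x.1) = 0 by rewrite A1 mul0r.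
  by rewrite /orient /cross /vec /= => h; apply/eqP; rewrite -subr_eq0 -h; apply/eqP; ring.
- have : orient w x q * (k.2 - x.2) = 0 by rewrite A1 mul0r.
  by rewrite /orient /cross /vec /= => h; apply/eqP; rewrite -subr_eq0 -h; apply/eqP; ring.
Qed.

(** If the angle reached 2 pi during a slide, q would lie on the inner side of k w and of x k, and
    on the closed inner side of w x. Hence q is either inside the open face k w x, which the marked
    edge avoids, or on the edge x w, which is then the marked one. *)
Lemma slide_step (R : realType) (P : vertex -> R * R) (s kappa eta : R)
    (k d : vertex) (alpha beta alpha' beta' : R) :
  let q := lerp (P 0) (P (1, 0)) s in
  let w := vadd k d in let x := vadd k (vrot d) in
  hex_drawing P -> 0 < s < 1 -> 0 < len (vec (P 0) q) ->
  len (vec (P 0) q) < len (vec (P 0) (P (1, 0))) ->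
  d \in unit_steps -> x != (1, 0) ->
  len (vec (P k) (P x)) <= kappa -> kappa <= len (vec (P k) (P w)) ->
  2 * kappa < len (vec (P k) q) ->
  0 < len (vec (P k) (P w)) ->
  has_angle (vec (P k) (P w)) alpha -> has_angle (vec (P k) q) beta ->
  has_angle (vec (P x) (P w)) (alpha + alpha') ->
  has_angle (vec (P x) q) (beta + beta') ->
  `|alpha'| <= eta -> `|beta'| <= eta -> 6 * eta <= pi ->
  alpha - beta < pi *+ 2 ->
  alpha + alpha' - (beta + beta') < pi *+ 2 \/ x = 0 /\ w = (1, 0).
Proof.
move=> q w x hP s01 q0 q1 hd x1 kx kw kq w0 ha hb ha' hb'.
rewrite !ler_norml => na nb eta6 lt2.
have [?|ge2] := ltP (alpha + alpha' - (beta + beta')) (pi *+ 2); [by left|right].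
have [hO hE hF] := hP; have D0 := hO k d hd; have pi0 := pi_gt0 R.
have k0 : 0 <= kappa by exact: le_trans (len_ge0 _) kx.
have kq0 : 0 < len (vec (P k) q) by lra.
(* The angle still missing before the slide; the two small rotations bound it by 2 eta, hence by pi
   / 3. *)
set c := pi *+ 2 - (alpha - beta).
have c0 : 0 < c by rewrite /c; lra.
have c1 : c <= 2 * eta by rewrite /c; lra.
have Bval : orient (P k) (P w) q = len (vec (P k) (P w)) * len (vec (P k) q) * sin c.
  by rewrite /orient (angle_cross ha hb) -sinD2pi; congr (_ * sin _); rewrite /c; ring.
have B0 : 0 < orient (P k) (P w) q.
  by rewrite Bval !mulr_gt0 // sin_gt0_pi //; apply/andP; split; lra.
have A0 : 0 <= orient (P w) (P x) q.
  have -> : orient (P w) (P x) q = - orient (P x) (P w) q.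
    by rewrite /orient /cross /vec /=; ring.
  rewrite /orient (angle_cross ha' hb') -mulrN mulr_ge0 ?mulr_ge0 ?len_ge0 //.
  set y := alpha + alpha' - (beta + beta') in ge2.
  have -> : - sin (beta + beta' - (alpha + alpha')) = sin (y - pi *+ 2).
    by rewrite -sinN -[in RHS]sinD2pi; congr sin; rewrite /y; ring.
  by apply: sin_ge0_pi; rewrite /y in ge2 *; apply/andP; split; lra.
have hdot : dot (vec (P k) (P w)) (vec (P k) q) =
    len (vec (P k) (P w)) * len (vec (P k) q) * cos c.
  by rewrite (angle_dot ha hb) -cosD2pi; congr (_ * cos _); rewrite /c; ring.
have cc : 1 / 2 <= cos c.
  rewrite -cos_pi3 leNgt ltr_cos ?in_itv /= -?leNgt; first lra.
  - by apply/andP; split; lra.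
  - by apply/andP; split; lra.
have hsum := orient_sum (P k) (P w) (P x) q.
have C0 : 0 < orient (P x) (P k) q.
  rewrite ltNge; apply/negP => C0.
  (* Write q - k in barycentric coordinates as a combination of w - k and x - k, and take the dot
     product with w - k. If C <= 0, this forces the distance from k to q to be at most 2 kappa. *)
  have key : orient (P k) (P w) (P x) * dot (vec (P k) (P w)) (vec (P k) q) =
      orient (P k) (P w) q * dot (vec (P k) (P x)) (vec (P k) (P w)) +
      orient (P x) (P k) q * len (vec (P k) (P w)) ^+ 2.
    by rewrite len_sqr /orient /cross /dot /vec /=; ring.
  have hd1 : dot (vec (P k) (P x)) (vec (P k) (P w)) <= kappa * len (vec (P k) (P w)).
    by apply: le_trans (dot_le_len _ _) _; rewrite ler_pM2r.
  move: key D0 hd1 hsum; rewrite hdot -/x.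
  set lw := len (vec (P k) (P w)) in kw w0 *; set lq := len (vec (P k) q) in kq kq0 *.
  set D := orient (P k) (P w) (P x); set B := orient (P k) (P w) q in B0 *.
  set A := orient (P w) (P x) q in A0 *; set C := orient (P x) (P k) q in C0 *.
  move=> key D0 hd1 hsum.
  have h1 : D * (lw * lq * cos c) <= B * (kappa * lw) + C * lw ^+ 2.
    by rewrite key lerD2r ler_pM2l.
  have h2 : D * (lw * lq * (1 / 2)) <= D * (lw * lq * cos c).
    by rewrite ler_pM2l // ler_pM2l // mulr_gt0.
  have h3 : B * (kappa * lw) <= (D - C) * (kappa * lw).
    by rewrite ler_wpM2r ?mulr_ge0 ?len_ge0 //; lra.
  have h4 : C * lw * (lw - kappa) <= 0.
    by rewrite mulr_le0_ge0 ?subr_ge0 // mulr_le0_ge0 // ltW.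
  have h5 : D * lw * lq <= D * lw * (2 * kappa) by lra.
  by move: h5; rewrite ler_pM2l ?mulr_gt0 // leNgt kq.
have xw : neighbor x w.
  by rewrite /w -(vadd_vrot_vunrot k d) neighbor_vadd vunrot_unit.
have [A1|A1] := ltP 0 (orient (P w) (P x) q).
  have n01 : neighbor 0 (1, 0) by [].
  case: (hF 0 (1, 0) k d q n01 hd) => //.
  by exists s => //; case/andP: s01 => h1 h2; rewrite !ltW.
have {A0}A1 : orient (P w) (P x) q = 0 by apply/eqP; rewrite eq_le A1 A0.
have sq := on_segment_side D0 A1 (ltW C0) (ltW B0).
have [//|[e1 _]] := marker_edge hP s01 q0 q1 xw sq.
by rewrite e1 eqxx in x1.
Qed.

(** * Finite patches and the contradiction along the walk *)

Fixpoint patch (n : nat) : seq vertex :=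
  if n is m.+1 then patch m ++ [seq vadd v d | v <- patch m, d <- unit_steps]
  else [:: 0].

Lemma patchS (n : nat) :
  patch n.+1 = patch n ++ [seq vadd v d | v <- patch n, d <- unit_steps].
Proof. by []. Qed.

Lemma patch_mono (m n : nat) : (m <= n)%N -> {subset patch m <= patch n}.
Proof.
move=> /subnK <-; elim: (n - m)%N => // j IH v /IH h.
by rewrite addSn patchS mem_cat h.
Qed.

Lemma patch_vadd (n : nat) (v d : vertex) :
  v \in patch n -> d \in unit_steps -> vadd v d \in patch n.+1.
Proof.
move=> hv hd; rewrite patchS mem_cat; apply/orP; right.
by apply/allpairsP; exists (v, d).
Qed.

Lemma walk_patch (big : pred vertex) (s : vertex * vertex) (n : nat) :
  s.1 = 0 -> s.2 \in unit_steps ->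
  ((walk big s n).1 \in patch n) && ((walk big s n).2 \in unit_steps).
Proof.
move=> s1 s2; elim: n => [|n /andP[ih1 ih2]]; first by rewrite /= s1 s2 inE eqxx.
rewrite /walk iterS -/(walk big s n) /walk_step; case: ifP => _.
  by rewrite (patch_mono (leqnSn n)) ?vrot_unit.
by rewrite patch_vadd ?vrot_unit //= vunrot_unit.
Qed.

Lemma vadd0 (d : vertex) : vadd 0 d = d.
Proof. by rewrite /vadd /= !add0r; case: d. Qed.

Lemma vec_vec (R : realType) (a c z : R * R) : vec (vec a z) (vec c z) = vec c a.
Proof. by rewrite /vec /=; congr pair; ring. Qed.

(** Here b is the scale of the big radii, kappa bounds the tiny edges, eta bounds the rotation
    caused by a slide, and gam is the excess over pi / 3 at a turn. Around the image of 0, the tiny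
    vertices of the walk stay within 22 kappa <= b / 8, whence the constant 176, its big vertices
    stay beyond b / 2, and q sits at distance b / 4. The patch of radius 23 contains 22 steps and
    the vertex ahead. *)
Lemma border_absurd (R : realType) (P : vertex -> R * R) (big : pred vertex)
    (Q : seq vertex)    (b kappa kappa0 eta gam : R) :
  {subset patch 23 <= Q} ->
  hex_drawing P -> 0 < b -> ~~ big 0 -> big (1, 0) ->
  (forall k x, k \in Q -> x \in Q -> neighbor k x ->
     ~~ big k -> ~~ big x -> len (vec (P k) (P x)) <= kappa) ->
  (forall k w, k \in Q -> w \in Q -> neighbor k w ->
     ~~ big k -> big w -> 3 / 4 * b <= len (vec (P k) (P w))) ->
  (forall k u w, k \in Q -> u \in Q -> w \in Q ->
     neighbor k u -> neighbor k w -> neighbor u w -> ~~ big k -> big u -> big w ->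
     dot (vec (P k) (P u)) (vec (P k) (P w)) <=
       cos (pi / 3 + gam) * (len (vec (P k) (P u)) * len (vec (P k) (P w)))) ->
  (forall u v : R * R, 0 < len u -> len (vec u v) <= kappa0 * len u ->
     forall a, has_angle u a -> exists2 c, `|c| <= eta & has_angle v (a + c)) ->
  0 <= kappa -> 0 < kappa0 -> 176 * kappa <= b -> kappa <= kappa0 * (b / 8) -> 0 < eta ->
  46 * eta < 6 * gam -> pi / 3 + gam <= pi -> 6 * eta <= pi ->
  False.
Proof.
move=> hQ hP b0 big0 big1 hTT hTB hA hturn ka0 ka0' kab kak eta0 etag gpi etapi.
have [hO _ _] := hP; have pi0 := pi_gt0 R.
set s0 : vertex * vertex := (0, (1, 0)).
have n01 : neighbor 0 (1, 0) by [].
set L := len (vec (P 0) (P (1, 0))).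
have L0 : 3 / 4 * b <= L.
  by apply: hTB => //; apply: hQ; [exact: (patch_mono (leq0n 23)) | exact: (@patch_mono 1)].
pose s := b / 4 / L; have Lp : 0 < L by lra.
have s01 : 0 < s < 1.
  by rewrite divr_gt0 ?divr_gt0 //= ltr_pdivrMr // mul1r; lra.
set q := lerp (P 0) (P (1, 0)) s.
have lq : len (vec (P 0) q) = b / 4.
  by rewrite len_vec_lerp ?divfK ?gt_eqF //; case/andP: s01 => /ltW.
have q0 : 0 < len (vec (P 0) q) by rewrite lq; lra.
have q1 : len (vec (P 0) q) < len (vec (P 0) (P (1, 0))) by rewrite lq -/L; lra.
pose W n := walk big s0 n.
have WS n : W n.+1 = walk_step big (W n) by [].
have mem n : (n <= 22)%N -> [/\ (W n).1 \in Q, (W n).2 \in unit_steps,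
    far_end (W n) \in Q & ahead (W n) \in Q].
  move=> hn; have /andP[h1 h2] : ((W n).1 \in patch n) && ((W n).2 \in unit_steps).
    exact: walk_patch.
  have hp : forall d, d \in unit_steps -> vadd (W n).1 d \in Q.
    by move=> d hd; apply: hQ; apply: (@patch_mono n.+1) => //; exact: patch_vadd.
  split=> //; first by apply: hQ; apply: patch_mono h1; exact: leq_trans hn _.
  - exact: hp.
  - by apply: hp; exact: vrot_unit.
have brd n : ~~ big (W n).1 && big (far_end (W n)) by exact: walk_border.
have ahn n : (n <= 22)%N -> neighbor (W n).1 (ahead (W n)).
  by move=> /mem[_ h _ _]; rewrite neighbor_vadd vrot_unit.
have fen n : (n <= 22)%N -> neighbor (W n).1 (far_end (W n)).
  by move=> /mem[_ h _ _]; rewrite neighbor_vadd.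
have near n : (n <= 22)%N -> len (vec (P 0) (P (W n).1)) <= n%:R * kappa.
  elim: n => [_|n IH hn].
    by rewrite /= /vec /len /= !subrr expr0n /= addr0 sqrtr0 mul0r.
  have hn' := ltnW hn; rewrite WS /walk_step; case: ifP => [_|tx] /=.
    by apply: le_trans (IH hn') _; rewrite ler_wpM2r // ler_nat.
  apply: le_trans (len_triangle _ (P (W n).1) _) _.
  rewrite -addn1 natrD mulrDl mul1r lerD ?IH //.
  have [h1 h2 h3 h4] := mem n hn'; have /andP[h5 h6] := brd n.
  by apply: hTT; rewrite ?tx ?ahn.
have nearb n : (n <= 22)%N -> len (vec (P 0) (P (W n).1)) <= b / 8.
  move=> hn; apply: le_trans (near n hn) _.
  apply: (@le_trans _ _ (22%:R * kappa)); first by rewrite ler_wpM2r // ler_nat.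
  lra.
have far n : (n <= 22)%N -> 3 / 4 * b <= len (vec (P (W n).1) (P (far_end (W n)))).
  move=> hn; have [h1 h2 h3 h4] := mem n hn; have /andP[h5 h6] := brd n.
  by apply: hTB => //; exact: fen.
(* 3/4 b - b/8 exceeds b/2. *)
have off v n : (n <= 22)%N -> 3 / 4 * b <= len (vec (P (W n).1) (P v)) ->
    b / 2 < len (vec (P 0) (P v)).
  move=> hn hv; have := len_triangle (P (W n).1) (P 0) (P v).
  by rewrite [len (vec _ (P 0))]len_vecC; have := nearb n hn; lra.
have kq n : (n <= 22)%N -> b / 8 <= len (vec (P (W n).1) q) <= 3 / 8 * b.
  move=> hn; have := nearb n hn.
  have := len_triangle (P 0) (P (W n).1) q.
  have := len_triangle (P (W n).1) (P 0) q.
  rewrite [len (vec (P (W n).1) (P 0))]len_vecC lq; lra.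
(* A property that propagates along pieces of edges inside the disc of radius b / 2 passes from the
   current tiny vertex to q: go back along the tiny edges to the image of 0, then along the marked
   edge. *)
have reach n : (n <= 22)%N -> forall S : R * R -> Prop,
    (forall a c x y, neighbor a c -> on_segment (P a) (P c) x ->
       on_segment (P a) (P c) y -> len (vec (P 0) x) <= b / 2 ->
       len (vec (P 0) y) <= b / 2 -> S x -> S y) ->
    S (P (W n).1) -> S q.
  elim: n => [_ S hS|n IH hn S hS].
    apply: (hS _ _ _ _ n01); first exact: on_segment_start.
    - by exists s => //; case/andP: s01 => h1 h2; rewrite !ltW.
    - have : len (vec (P 0) (P 0)) <= b / 8 by exact: (nearb 0%N).
      lra.
    - by rewrite lq; lra.
  have hn' := ltnW hn; have := nearb n.+1 hn; rewrite WS /walk_step.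
  case: ifP => [_ _|tx] /=; first exact: IH.
  move=> h hx; apply: (IH hn' S hS).
  apply: (hS _ _ _ _ (ahn n hn') _ _ _ _ hx).
  - exact: on_segment_end.
  - exact: on_segment_start.
  - lra.
  - have := nearb n hn'; lra.
have natS n : n.+1%:R = n%:R + 1 :> R by rewrite -addn1 natrD.
(* Each turn adds at least pi / 3 + gam to the swept angle al - be, and each step loses at most 2
   eta. The angle can reach 2 pi only when the walk has returned to its start, and then exceeds it
   by at most 2 eta. *)
pose inv n := exists al be, [/\ has_angle (vec (P (W n).1) (P (far_end (W n)))) al,
  has_angle (vec (P (W n).1) q) be,
  (turns big s0 n)%:R * (pi / 3 + gam) - n%:R * (2 * eta) <= al - be,
  al - be <= pi *+ 2 + 2 * eta &
  al - be < pi *+ 2 \/ (0 < n)%N /\ W n = s0].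
have inv0 : inv 0%N.
  have [a ha] := exists_angle Lp.
  have s0' : 0 <= s by case/andP: s01 => /ltW.
  have ha' := angle_lerp s0' ha.
  (* The marker lies on the starting edge, so the swept angle starts at 0. *)
  exists a, a; rewrite /turns big_ord0 !mul0r !subr0 subrr.
  have e : far_end (W 0%N) = (1, 0) by rewrite /far_end /= vadd0.
  by rewrite e; split=> //; [lra | left; rewrite mulrn_wgt0].
have invS n : (n < 22)%N -> (n = 0%N \/ W n != s0) -> inv n -> inv n.+1.
  move=> hn hns [al [be [ha hb hlow hup hlt]]].
  have {hlt}lt2 : al - be < pi *+ 2.
    case: hlt => // -[n0 e]; case: hns => [e0|]; first by rewrite e0 in n0.
    by rewrite e eqxx.
  have hn' := ltnW hn; have [m1 m2 m3 m4] := mem n hn'.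
  have /andP[tk bw] := brd n.
  have k1 : (W n).1 != (1, 0) by apply: contraNneq tk => ->.
  have w0 : 0 < len (vec (P (W n).1) (P (far_end (W n)))).
    by have := far n hn'; clear - b0; lra.
  have /andP[kq1 kq2] := kq n hn'.
  have kq0 : 0 < len (vec (P (W n).1) q) by clear - b0 kq1; lra.
  have tS : turns big s0 n.+1 = (turns big s0 n + big (ahead (W n)))%N.
    by rewrite /turns big_ord_recr.
  have [bx|tx] := boolP (big (ahead (W n))).
    have e : W n.+1 = ((W n).1, vrot (W n).2) by rewrite WS /walk_step bx.
    have fw' : 3 / 4 * b <= len (vec (P (W n).1) (P (ahead (W n)))).
      by apply: hTB => //; exact: ahn.
    have w'0 : 0 < len (vec (P (W n).1) (P (ahead (W n)))) by clear - b0 fw'; lra.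
    have [g [gbd hg cg sg]] := angle_turn w0 w'0 ha.
    have g0 : 0 <= g by apply: sg; apply: ltW; exact: hO.
    have gg : pi / 3 + gam <= g.
      apply: ge_angle; [by clear - pi0 eta0 etag gpi; lra | by rewrite g0; case/andP: gbd |].
      rewrite cg ler_pdivrMr ?mulr_gt0 //; apply: hA => //.
      - exact: fen.
      - exact: ahn.
      - rewrite -[far_end _]vadd_vrot_vunrot neighborC.
        by rewrite neighbor_vadd vunrot_unit.
    (* The apex is not in its own open cone, and by [no_entry] the drawn path from the apex to q
       never enters it. *)
    have nc : ~ in_cone (P (W n).1) (P (far_end (W n))) (P (ahead (W n))) q.
      apply: (reach n hn' (fun z => ~ in_cone (P (W n).1) (P (far_end (W n)))
        (P (ahead (W n))) z)).
        move=> a c x y nac sx sy nx ny.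
        apply: (no_entry hP m2 nac _ _ _ sx sy nx ny).
        - by have := nearb n hn'; clear - b0; lra.
        - by apply: (off _ n hn'); exact: far.
        - by apply: (off _ n hn').
      move=> [+ _]; rewrite /orient /cross /vec /= !subrr !mulr0 subrr ltxx //.
    have kqw : len (vec (P (W n).1) q) <= len (vec (P (W n).1) (P (ahead (W n)))).
      by clear - b0 kq2 fw'; lra.
    have gpi' : g <= pi by case/andP: gbd.
    have [le2 ret] := turn_step hP s01 q0 q1 m2 k1 w0 kq0 kqw nc ha hb hg gpi' lt2.
    have eT : (turns big s0 n + true)%:R = (turns big s0 n)%:R + 1 :> R by rewrite natrD.
    exists (al + g), be; rewrite e tS bx; split=> //.
    - by rewrite eT natS; clear - hlow gg eta0; lra.
    - by clear - le2 eta0; lra.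
    - case: ret => [|[e1 e2]]; [by left|right; split=> //].
      by move: e2; rewrite e1 vadd0 => ->.
  have e : W n.+1 = (ahead (W n), vunrot (W n).2) by rewrite WS /walk_step (negbTE tx).
  have e' : far_end (W n.+1) = far_end (W n).
    by rewrite e /far_end /ahead /= vadd_vrot_vunrot.
  have x1 : ahead (W n) != (1, 0) by apply: contraNneq tx => ->.
  have kx : len (vec (P (W n).1) (P (ahead (W n)))) <= kappa.
    by apply: hTT => //; exact: ahn.
  have kw : kappa <= len (vec (P (W n).1) (P (far_end (W n)))).
    by have := far n hn'; clear - b0 kab; lra.
  have turn z : b / 8 <= len (vec (P (W n).1) z) -> forall a,
      has_angle (vec (P (W n).1) z) a ->
      exists2 c, `|c| <= eta & has_angle (vec (P (ahead (W n))) z) (a + c).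
    move=> hz; apply: hturn; first by clear - b0 hz; lra.
    rewrite vec_vec len_vecC; apply: le_trans kx _; apply: le_trans kak _.
    by rewrite ler_pM2l.
  have wz : b / 8 <= len (vec (P (W n).1) (P (far_end (W n)))).
    by have := far n hn'; clear - b0; lra.
  have [a' na ha'] := turn _ wz _ ha.
  have [c' nc hc'] := turn _ kq1 _ hb.
  have kq' : 2 * kappa < len (vec (P (W n).1) q) by clear - b0 kq1 kab; lra.
  have ret := slide_step hP s01 q0 q1 m2 x1 kx kw kq' w0 ha hb ha' hc' na nc etapi lt2.
  have := na; have := nc; rewrite !ler_norml => nc' na'.
  exists (al + a'), (be + c'); rewrite e' e tS (negbTE tx) addn0; split=> //.
  - by rewrite natS; clear - hlow na' nc'; lra.
  - by clear - lt2 na' nc'; lra.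
  - case: ret => [|[e1 e2]]; [by left|right; split=> //].
    have := vadd_vrot_vunrot (W n).1 (W n).2.
    by rewrite e1 vadd0 e2 /ahead e1 => ->.
have [N hN [[tN hs]|[V [K [V0 hV hK enc]]]]] := border_dichotomy big0 big1; last first.
  apply: (enclosed_absurd (rho := b / 2) (o := P 0) hP V0 enc).
  - move=> v /hV /mapP[m]; rewrite mem_iota add0n => /andP[_ hm] ->.
    have hm' : (m <= 22)%N by rewrite -ltnS; exact: leq_trans hm _.
    by apply: (off _ m hm'); exact: far.
  - move=> v /hK /mapP[m]; rewrite mem_iota add0n => /andP[_ hm] ->.
    have hm' : (m <= 22)%N by rewrite -ltnS; exact: leq_trans hm _.
    by apply: le_trans (nearb m hm') _; clear - b0; lra.
have invN n : (n <= N)%N -> inv n.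
  elim: n => // n IH hn; apply: invS; first exact: leq_trans hn hN.
    by case: n {IH} hn => [|n] hn; [left|right; exact: hs].
  exact: IH (ltnW hn).
have [al [be [_ _ hlow hup _]]] := invN N (leqnn N).
(* Six turns give at least 2 pi + 6 gam - 44 eta, against the upper bound 2 pi + 2 eta; this is
   where 46 eta < 6 gam is used. *)
have : N%:R * (2 * eta) <= 22%:R * (2 * eta).
  by rewrite ler_wpM2r ?ler_nat //; clear - eta0; lra.
by move: hlow; rewrite tN; clear - hup etag; lra.
Qed.

(** * Scales of radii *)

Lemma seq_upper_bound (R : realType) (T : eqType) (f : T -> R) (s : seq T) :
  exists M, forall x, x \in s -> f x <= M.
Proof.
elim: s => [|x s [M hM]]; first by exists 0.
exists (Num.max (f x) M) => y; rewrite inE le_max => /orP[/eqP ->|/hM ->].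
  by rewrite lexx.
by rewrite orbT.
Qed.

Lemma seq_lower_bound (R : realType) (T : eqType) (f : T -> R) (s : seq T) :
  (forall x, x \in s -> 0 < f x) ->
  exists2 e, 0 < e & forall x, x \in s -> e <= f x.
Proof.
elim: s => [_|x s IH h]; first by exists 1.
have [y hy|e e0 he] := IH; first by apply: h; rewrite inE hy orbT.
exists (Num.min (f x) e); first by rewrite lt_min e0 h // inE eqxx.
by move=> y; rewrite inE ge_min => /orP[/eqP ->|/he ->]; rewrite ?lexx ?orbT.
Qed.

(** Pigeonhole: the size s + 1 disjoint intervals [e^(j+1), e^j) cannot all contain an element of s,
    since the position of the first element in each would be an injection into size s places. *)
Lemma geometric_gap (R : realType) (e : R) (s : seq R) : 0 < e < 1 ->
  exists2 j, (j <= size s)%N & forall x, x \in s -> x < e ^+ j -> x < e ^+ j.+1.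
Proof.
move=> /andP[e0 e1].
pose hit (j : nat) (x : R) := (e ^+ j.+1 <= x) && (x < e ^+ j).
have [[j hj]|] := pselect (exists j : 'I_(size s).+1, ~~ has (hit j) s).
  exists j; first by rewrite -ltnS.
  move=> x xs xj; rewrite ltNge; apply/negP => h.
  by case/hasP: hj; exists x => //; rewrite /hit h.
move=> none; have all_hit (j : 'I_(size s).+1) : has (hit j) s.
  by apply: contra_notT none => h; exists j.
pose f (j : 'I_(size s).+1) : 'I_(size s) :=
  Ordinal (eq_ind _ is_true (all_hit j) _ (has_find (hit j) s)).
have lt_hit i j x : hit i x -> hit j x -> (i < j)%N -> False.
  move=> /andP[h _] /andP[_ h'] ij.
  have : e ^+ j <= e ^+ i.+1 by rewrite ler_wiXn2l // ltW.
  by move=> /(lt_le_trans h') /(le_lt_trans h); rewrite ltxx.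
have : injective f.
  move=> i j /(congr1 val) /= fij.
  have hi := nth_find 0 (all_hit i); have hj := nth_find 0 (all_hit j).
  rewrite fij in hi; apply: val_inj.
  have [ij|ij|//] := ltngtP (val i) (val j).
    by case: (lt_hit _ _ _ hi hj ij).
  by case: (lt_hit _ _ _ hj hi ij).
by move=> /leq_card; rewrite !card_ord ltnn.
Qed.

Lemma dot_cosine_law (R : realType) (k u w : R * R) :
  dot (vec k u) (vec k w) =
  (len (vec k u) ^+ 2 + len (vec k w) ^+ 2 - len (vec u w) ^+ 2) / 2.
Proof. by rewrite !len_sqr /dot /vec /=; field. Qed.

(** The law of cosines at a tiny vertex of radius k: the sides l1, l2 are nearly u, w, so the dot
    product d is nearly - I3 u w, at most (1/2 - delta) u w. Half of delta pays for the errors. *)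
Lemma wide_angle (R : realType) (M delta e k u w I1 I2 I3 l1 l2 d : R) :
  0 < k -> 0 < u -> 0 < w -> k <= e * u -> k <= e * w ->
  0 < e -> e <= 1 / 4 -> 1 <= M -> e * (2 * M + 2) <= delta / 2 -> delta <= 1 / 4 ->
  - (1 / 2) < I1 -> - (1 / 2) < I2 -> I1 <= M -> I2 <= M ->
  - (1 / 2) + delta <= I3 ->
  0 <= l1 -> 0 <= l2 ->
  l1 ^+ 2 = k ^+ 2 + u ^+ 2 + 2 * I1 * k * u ->
  l2 ^+ 2 = k ^+ 2 + w ^+ 2 + 2 * I2 * k * w ->
  d = (l1 ^+ 2 + l2 ^+ 2 - (u ^+ 2 + w ^+ 2 + 2 * I3 * u * w)) / 2 ->
  d <= (1 / 2 - delta / 2) * (l1 * l2).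
Proof.
move=> k0 u0 w0 ku kw e0 e1 M1 he hd i1 i2 m1 m2 i3 l10 l20 h1 h2 ->.
have side v I l : 0 < v -> k <= e * v -> - (1 / 2) < I -> 0 <= l ->
    l ^+ 2 = k ^+ 2 + v ^+ 2 + 2 * I * k * v -> (1 - e) * v <= l.
  move=> v0 kv i l0 h; apply: ler_of_sqr => //; rewrite h.
  have kv0 : 0 < k * v by rewrite mulr_gt0.
  have : - (k * v) <= 2 * I * (k * v) by rewrite -mulN1r ler_wpM2r //; lra.
  have : k * v <= e * v * v by rewrite ler_wpM2r // ltW.
  have : 0 <= k ^+ 2 by rewrite sqr_ge0.
  have : e * (e * v ^+ 2) <= 1 * (e * v ^+ 2).
    have ev : 0 <= e * v ^+ 2 by rewrite mulr_ge0 ?sqr_ge0 // ltW.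
    by rewrite ler_wpM2r //; lra.
  nra.
have s1 := side _ _ _ u0 ku i1 l10 h1; have s2 := side _ _ _ w0 kw i2 l20 h2.
have uw0 : 0 < u * w by rewrite mulr_gt0.
have ll : (1 - 2 * e) * (u * w) <= l1 * l2.
  apply: (@le_trans _ _ ((1 - e) * u * ((1 - e) * w))).
    have : 0 <= e ^+ 2 * (u * w) by rewrite mulr_ge0 ?sqr_ge0 // ltW.
    lra.
  by apply: ler_pM => //; rewrite mulr_ge0 // ?ltW //; lra.
have ll' : (1 / 2 - delta / 2) * ((1 - 2 * e) * (u * w)) <= (1 / 2 - delta / 2) * (l1 * l2).
  by rewrite ler_wpM2l //; lra.
apply: le_trans ll'; rewrite h1 h2.
(* The dot product equals k^2 + I1 k u + I2 k w - I3 u w. Its first three terms cost e (2 M + 1) u w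
   and the bound on l1 l2 costs about e u w; together at most delta / 2 times u w. *)
have a1 : I1 * (k * u) <= M * (e * (u * w)).
  apply: (@le_trans _ _ (M * (k * u))).
    by rewrite ler_wpM2r // mulr_ge0 // ltW.
  rewrite ler_wpM2l //; first lra.
  by rewrite [e * _](_ : _ = (e * w) * u); [rewrite ler_wpM2r // ltW | ring].
have a2 : I2 * (k * w) <= M * (e * (u * w)).
  apply: (@le_trans _ _ (M * (k * w))).
    by rewrite ler_wpM2r // mulr_ge0 // ltW.
  rewrite ler_wpM2l //; first lra.
  by rewrite mulrA ler_wpM2r // ltW.
have a3 : (- (1 / 2) + delta) * (u * w) <= I3 * (u * w) by rewrite ler_wpM2r // ltW.
have a4 : k ^+ 2 <= e * (u * w).
  apply: (@le_trans _ _ (e * u * (e * w))); first by rewrite expr2 ler_pM // ltW.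
  have : e * (e * (u * w)) <= 1 * (e * (u * w)).
    have ev : 0 <= e * (u * w) by rewrite mulr_ge0 // ltW.
    by rewrite ler_wpM2r //; lra.
  lra.
have a5 : e * (2 * M + 2) * (u * w) <= delta / 2 * (u * w) by rewrite ler_wpM2r // ltW.
have a6 : 0 <= delta * (e * (u * w)).
  by rewrite !mulr_ge0 // ?ltW //; nra.
lra.
Qed.

(** Converts the margin in the cosine into a margin in the angle, as the cosine decreases on
    [0, pi]. *)
Lemma angle_margin (R : realType) (delta : R) : 0 < delta -> delta <= 1 / 4 ->
  exists2 gam, 0 < gam & pi / 3 + gam <= pi /\ cos (pi / 3 + gam) = 1 / 2 - delta / 2.
Proof.
move=> d0 d1; have pi0 := pi_gt0 R.
have rng : -1 <= 1 / 2 - delta / 2 <= 1 by apply/andP; split; lra.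
have a0 := acos_ge0 rng; have a1 := acos_lepi rng.
have ca : cos (acos (1 / 2 - delta / 2)) = 1 / 2 - delta / 2.
  by rewrite acosK // in_itv.
exists (acos (1 / 2 - delta / 2) - pi / 3).
  rewrite subr_gt0 -ltr_cos ?in_itv /= ?a0 //; last by apply/andP; split; lra.
  by rewrite ca cos_pi3; lra.
by rewrite addrC subrK.
Qed.

(** The normalized case: v0 is (1, 0) and vk is 0. The constant depends only on the bounds of I over
    the edges of a finite patch. If it fails, [geometric_gap] gives a threshold b such that every
    radius of the patch is at least b or below e b, with (1, 0) big and 0 tiny. *)
Lemma drawing_ring_lemma (R : realType) (I : vertex -> vertex -> R) :
  (forall u v, neighbor u v -> - (1 / 2) < I u v) ->
  exists C : R, 0 < C /\ forall (r : vertex -> R) (P : vertex -> R * R),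
    (forall v, 0 < r v) -> hex_drawing P ->
    (forall u v, neighbor u v -> len (vec (P u) (P v)) ^+ 2 =
       r u ^+ 2 + r v ^+ 2 + 2 * I u v * r u * r v) ->
    r (1, 0) <= C * r 0.
Proof.
(* The list is hidden behind an existential so that it is never unfolded. *)
move=> hI; have [Q hQ] : exists Q : seq vertex, {subset patch 23 <= Q} by exists (patch 23).
pose E := [seq e <- [seq (u, v) | u <- Q, v <- Q] | neighbor e.1 e.2].
have memE u v : u \in Q -> v \in Q -> neighbor u v -> (u, v) \in E.
  by move=> hu hv nuv; rewrite mem_filter nuv; apply/allpairsP; exists (u, v).
have [M0 hM0] := seq_upper_bound (fun e => I e.1 e.2) E.
have [d0 d00 hd0] : exists2 d, 0 < d & forall e, e \in E -> d <= I e.1 e.2 + 1 / 2.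
  apply: seq_lower_bound => e; rewrite mem_filter => /andP[/hI h _]; lra.
pose M := Num.max 1 M0; pose delta := Num.min (1 / 4) d0.
have M1 : 1 <= M by rewrite le_max lexx.
have hM u v : u \in Q -> v \in Q -> neighbor u v -> I u v <= M.
  by move=> hu hv nuv; rewrite le_max (hM0 _ (memE u v hu hv nuv)) orbT.
have dl0 : 0 < delta by rewrite lt_min d00 andbT; lra.
have dl1 : delta <= 1 / 4 by rewrite ge_min lexx.
have hd u v : u \in Q -> v \in Q -> neighbor u v -> - (1 / 2) + delta <= I u v.
  move=> hu hv nuv; have := hd0 _ (memE u v hu hv nuv) => /= h.
  have : delta <= d0 by rewrite ge_min lexx orbT.
  lra.
have [gam gam0 [gampi hcos]] := angle_margin dl0 dl1.
have pi0 := pi_gt0 R.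
have eta0 : 0 < gam / 10 by rewrite divr_gt0.
have [kappa0 kap0 hturn] := small_turn eta0.
(* Tiny edges will have length at most m b. The three bounds serve the disc estimates, the small
   rotations at distance b / 8, and the error term of [wide_angle]. *)
pose m := Num.min (1 / 176) (Num.min (kappa0 / 8) (delta / 2)).
have m0 : 0 < m by rewrite !lt_min !divr_gt0.
have m1 : m <= 1 / 176 by rewrite ge_min lexx.
have m2 : m <= kappa0 / 8 by rewrite !ge_min lexx orbT.
have m3 : m <= delta / 2 by rewrite !ge_min lexx !orbT.
have MM : 0 < 2 * M + 2 by lra.
(* Two radii below e b joined by a weight at most M give a squared length at most (2 M + 2) (e b)^2,
   hence at most (m b)^2. *)
pose e := m / (2 * M + 2).
have e0 : 0 < e by rewrite divr_gt0.
have em : e * (2 * M + 2) = m by rewrite divfK // gt_eqF.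
have e1 : e <= 1 / 4 by nra.
exists (e ^+ (size Q).+1)^-1; split; first by rewrite invr_gt0 exprn_gt0.
move=> r P r0 hP hl; rewrite leNgt; apply/negP => hbad.
have {}hbad : r 0 < e ^+ (size Q).+1 * r (1, 0).
  by rewrite -ltr_pdivrMl ?exprn_gt0.
have e01 : 0 < e < 1 by rewrite e0 /=; lra.
have [j jQ hgap] := geometric_gap [seq r v / r (1, 0) | v <- Q] e01.
rewrite size_map in jQ.
pose b := e ^+ j * r (1, 0); pose big (v : vertex) := b <= r v.
have b0 : 0 < b by rewrite mulr_gt0 // exprn_gt0.
have small v : v \in Q -> ~~ big v -> r v < e * b.
  move=> vQ; rewrite /big -ltNge => h.
  have := hgap (r v / r (1, 0)) (map_f _ vQ).
  by rewrite !ltr_pdivrMr // => /(_ h); rewrite exprS -mulrA.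
have big1 : big (1, 0).
  have ej : e ^+ j <= 1 by apply: exprn_ile1; lra.
  by rewrite /big /b ler_piMl // ltW.
(* The exponent size Q + 1 exceeds every possible j, so r 0 falls below the threshold wherever the
   gap is. *)
have big0 : ~~ big 0.
  rewrite /big -ltNge; apply: lt_trans hbad _; rewrite ltr_pM2r //.
  apply: (@le_lt_trans _ _ (e ^+ j.+1)); first by rewrite ler_wiXn2l // ltW //; lra.
  by rewrite exprS gtr_pMl ?exprn_gt0 //; lra.
have tiny_edge k w : neighbor k w -> k \in Q -> ~~ big k -> big w ->
    [/\ r k <= e * r w & 3 / 4 * b <= len (vec (P k) (P w))].
  move=> nkw kQ tk bw; have rk := small k kQ tk; rewrite /big in bw.
  have kw : r k <= e * r w by apply: (le_trans (ltW rk)); rewrite ler_pM2l.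
  split=> //; apply: (@le_trans _ _ (3 / 4 * r w)); first by rewrite ler_pM2l //; lra.
  apply: ler_of_sqr; rewrite ?len_ge0 // hl //.
  have h1 := hI _ _ nkw; have p : 0 < r k * r w by rewrite mulr_gt0.
  have h2 : - (r k * r w) <= 2 * I k w * (r k * r w).
    by rewrite -mulN1r ler_wpM2r ?ltW //; lra.
  (* As I > -1/2, the squared length is at least (r k - r w / 2)^2 + 3/4 (r w)^2, and 3/4 exceeds
     (3/4)^2. *)
  have := sqr_ge0 (r k - r w / 2); nra.
apply: (@border_absurd R P big Q b (m * b) kappa0 (gam / 10) gam) => //.
- move=> k x kQ xQ nkx tk tx; have rk := small k kQ tk; have rx := small x xQ tx.
  rewrite -em mulrAC; apply: ler_of_sqr.
    by apply: ltW; rewrite mulr_gt0 // mulr_gt0.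
  rewrite hl //; set t := e * b in rk rx *.
  have t0 : 0 < t by rewrite mulr_gt0.
  have a1 : r k ^+ 2 <= t ^+ 2 by rewrite ler_pXn2r ?nnegrE // ltW.
  have a2 : r x ^+ 2 <= t ^+ 2 by rewrite ler_pXn2r ?nnegrE // ltW.
  have a3 : r k * r x <= t ^+ 2 by rewrite expr2 ler_pM // ltW.
  have a4 : I k x * (r k * r x) <= M * (r k * r x).
    by rewrite ler_wpM2r ?hM // mulr_ge0 // ltW.
  have a5 : M * (r k * r x) <= M * t ^+ 2 by rewrite ler_wpM2l //; lra.
  have a6 : (2 * M + 2) * t ^+ 2 <= (2 * M + 2) ^+ 2 * t ^+ 2.
    by rewrite ler_wpM2r ?sqr_ge0 // expr2; nra.
  rewrite exprMn; lra.
- by move=> k w kQ wQ nkw tk bw; have [] := tiny_edge k w nkw kQ tk bw.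
- move=> k u w kQ uQ wQ nku nkw nuw tk bu bw; rewrite hcos.
  have [ku _] := tiny_edge k u nku kQ tk bu.
  have [kw _] := tiny_edge k w nkw kQ tk bw.
  apply: (wide_angle (r0 k) (r0 u) (r0 w) ku kw e0 e1 M1 _ dl1
    (hI _ _ nku) (hI _ _ nkw) (hM _ _ kQ uQ nku) (hM _ _ kQ wQ nkw)
    (hd _ _ uQ wQ nuw) (len_ge0 _) (len_ge0 _) (hl _ _ nku) (hl _ _ nkw)).
  - by rewrite em.
  - by rewrite -hl // dot_cosine_law.
- by rewrite mulr_ge0 // ltW.
- have : m * b <= 1 / 176 * b by rewrite ler_wpM2r // ltW.
  lra.
- by rewrite mulrA mulrAC ler_wpM2r // ltW.
- lra.
- lra.
Qed.

(** * From geometric triangulations to drawings *)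

Lemma continuous_lerp (R : realType) (a b : R * R) : continuous (lerp a b).
Proof.
have affine (c d : R) : continuous (fun t : R => c + t * d).
  by move=> t; apply: cvgD; [exact: cvg_cst | apply: cvgM; [exact: cvg_id | exact: cvg_cst]].
by move=> t; exact: cvg_pair (affine _ _ t) (affine _ _ t).
Qed.

Lemma lerp0 (R : realType) (a b : R * R) : lerp a b 0 = a.
Proof. by rewrite /lerp !mul0r !addr0; case: a. Qed.

Lemma lerp1 (R : realType) (a b : R * R) : lerp a b 1 = b.
Proof. by rewrite /lerp !mul1r !(addrC _ (_ - _)) !subrK; case: b. Qed.

Lemma lerp_same (R : realType) (a : R * R) (t : R) : lerp a a t = a.
Proof. by rewrite /lerp !subrr !mulr0 !addr0; case: a. Qed.

Lemma lerp_inj (R : realType) (a b : R * R) (s t : R) :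
  a <> b -> lerp a b s = lerp a b t -> s = t.
Proof.
move=> ab [/addrI h1 /addrI h2]; apply/eqP; apply: contra_notT ab => st.
have d0 : s - t != 0 by rewrite subr_eq0.
have e1 : b.1 - a.1 = 0 by apply: (mulfI d0); rewrite mulr0 mulrBl h1 subrr.
have e2 : b.2 - a.2 = 0 by apply: (mulfI d0); rewrite mulr0 mulrBl h2 subrr.
by rewrite [a]surjective_pairing [b]surjective_pairing -(subr0_eq e1) -(subr0_eq e2).
Qed.

(* An arc covering the segment between its ends is that segment: a point off
   the segment would disconnect the part of the arc lying over it. *)
Lemma arc_on_segment (R : realType) (phi : R * R -> R * R) (a b : R * R) :
  injective phi -> continuous phi ->
  (forall z, on_segment (phi a) (phi b) z ->
     exists2 y, on_segment a b y & phi y = z) ->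
  forall y, on_segment a b y -> on_segment (phi a) (phi b) (phi y).
Proof.
move=> phiI phiC cover y [t0 t01 ->].
have [->|/eqP ab] := eqVneq a b.
  rewrite lerp_same; exact: on_segment_start.
apply: contrapT => off.
(* The parameters on the target segment that are reached by the part [u, v] of the arc. If the point
   at t0 is off the segment, [L 0 t0] and [L t0 1] split [0, 1] into disjoint closed sets,
   containing 0 and 1 respectively. *)
pose L (u v : R) : set R := lerp (phi a) (phi b) @^-1` ((phi \o lerp a b) @` `[u, v]).
have closedL u v : closed (L u v).
  apply: closed_comp => [x _|]; first exact: continuous_lerp.
  apply: compact_closed; first exact: norm_hausdorff.
  apply: continuous_compact; last exact: segment_compact.
  apply: continuous_subspaceT => x; apply: continuous_comp; first exact: continuous_lerp.
  exact: phiC.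
have disj x : 0 <= x <= 1 -> L 0 t0 x -> L t0 1 x -> False.
  move=> x01 [s /=]; rewrite in_itv /= => s0 es [t]; rewrite /= in_itv /= => t1 et.
  have est := lerp_inj ab (phiI _ _ (etrans es (esym et))).
  have e : s = t0 by lra.
  by apply: off; exists x => //; rewrite -es /= e.
have separatedL : separated (L 0 t0 `&` `[0, 1]) (L t0 1 `&` `[0, 1]).
  have cl u v : closure (L u v `&` `[0, 1]) `<=` L u v `&` `[0, 1].
    suff /closure_id <- : closed (L u v `&` `[0, 1]) by [].
    by apply: closedI => //; exact: interval_closed.
  split; apply/seteqP; split=> // x [].
  - by move=> /cl[h1 /= h2] [h3 _]; apply: (disj x) => //; move: h2; rewrite in_itv.
  - by move=> [h1 /= h2] /cl[h3 _]; apply: (disj x) => //; move: h2; rewrite in_itv.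
have covL : `[0, 1] `<=` (L 0 t0 `&` `[0, 1]) `|` (L t0 1 `&` `[0, 1]).
  move=> x x01; have x01' : 0 <= x <= 1 by move: x01; rewrite /= in_itv.
  have [_ [t t1 ->] e] := cover _ (ex_intro2 _ _ x x01' erefl).
  have [tt|tt] := leP t t0; [left|right]; split=> //; exists t => //=;
    rewrite in_itv /=; lra.
case: (connected_subset separatedL covL (@segment_connected R 0 1)) => h.
- have [h1 _] : (L 0 t0 `&` `[0, 1]) 1 by apply: h; rewrite /= in_itv /= lexx ler01.
  apply: (disj 1) => //; first by rewrite ler01 lexx.
  by exists 1; rewrite /= ?in_itv /= ?lexx ?lerp1 //; lra.
- have [h1 _] : (L t0 1 `&` `[0, 1]) 0 by apply: h; rewrite /= in_itv /= lexx ler01.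
  apply: (disj 0) => //; first by rewrite ler01 lexx.
  by exists 0; rewrite /= ?in_itv /= ?lexx ?lerp0 //; lra.
Qed.

(** * Barycentric coordinates, lattice coordinates and open stars *)

Definition bary (R : realType) (a b c : R * R) (x y z : R) : R * R :=
  (x * a.1 + y * b.1 + z * c.1, x * a.2 + y * b.2 + z * c.2).

Lemma triangleP (R : realType) (a b c p : R * R) :
  triangle a b c p <-> exists x y z : R,
    [/\ 0 <= x, 0 <= y, 0 <= z, x + y + z = 1 & p = bary a b c x y z].
Proof.
split=> -[x [y [z]]].
  by move=> [[x0 y0 z0] [e ->]]; exists x, y, z.
by move=> [x0 y0 z0 e ->]; exists x, y, z.
Qed.

(** With [lattice2], the coordinates of p in the basis v1, v2. *)
Definition lattice1 (R : realType) (p : R * R) : R :=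
  p.1 - p.2 / sin (pi / 3) * cos (pi / 3).
Definition lattice2 (R : realType) (p : R * R) : R := p.2 / sin (pi / 3).

(* The interior of the union of the six faces around t, in lattice coordinates. *)
Definition open_star (R : realType) (t : vertex) (p : R * R) : Prop :=
  [/\ `|lattice1 p - t.1%:~R| < 1, `|lattice2 p - t.2%:~R| < 1 &
      `|lattice1 p + lattice2 p - t.1%:~R - t.2%:~R| < 1].

Lemma sin_pi3_gt0 (R : realType) : 0 < sin (pi / 3 : R).
Proof. by apply: sin_gt0_pi; have := pi_gt0 R; move=> ?; apply/andP; split; lra. Qed.

Lemma lattice1_position (R : realType) (v : vertex) : lattice1 (position R v) = v.1%:~R.
Proof. by rewrite /lattice1 /position /=; field; rewrite gt_eqF // sin_pi3_gt0. Qed.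

Lemma lattice2_position (R : realType) (v : vertex) : lattice2 (position R v) = v.2%:~R.
Proof. by rewrite /lattice2 /position /=; field; rewrite gt_eqF // sin_pi3_gt0. Qed.

Lemma lattice1_bary (R : realType) (a b c : R * R) (x y z : R) :
  lattice1 (bary a b c x y z) = x * lattice1 a + y * lattice1 b + z * lattice1 c.
Proof. by rewrite /lattice1 /bary /=; field; rewrite gt_eqF // sin_pi3_gt0. Qed.

Lemma lattice2_bary (R : realType) (a b c : R * R) (x y z : R) :
  lattice2 (bary a b c x y z) = x * lattice2 a + y * lattice2 b + z * lattice2 c.
Proof. by rewrite /lattice2 /bary /=; field; rewrite gt_eqF // sin_pi3_gt0. Qed.

Lemma small_int (R : realType) (i : int) : `|i%:~R : R| < 2 -> [\/ i = -1, i = 0 | i = 1].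
Proof.
rewrite -intr_norm (ltr_int R _ 2) => h.
have : (`|i| <= 1)%R by lia.
move=> h'; have [?|[?|?]] : i = -1 \/ i = 0 \/ i = 1 by lia.
- exact: Or31.
- exact: Or32.
- exact: Or33.
Qed.

Lemma unit_steps_ind (Q : vertex -> Prop) :
  Q (1, 0) -> Q (-1, 0) -> Q (0, 1) -> Q (0, -1) -> Q (1, -1) -> Q (-1, 1) ->
  forall d, d \in unit_steps -> Q d.
Proof.
move=> q1 q2 q3 q4 q5 q6 d; rewrite !inE.
by do 5?[case/orP]; move=> /eqP ->.
Qed.

(** After translation to the origin, membership in the star forces i and j into {-1, 0, 1}; nine
    centres and six directions leave finitely many linear problems. *)
Lemma unit_star (R : realType) (d : vertex) (i j : int) (y z : R) :
  d \in unit_steps -> 0 <= y -> 0 <= z -> y + z <= 1 ->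
  [/\ `|y * d.1%:~R + z * (vrot d).1%:~R - i%:~R| < 1,
      `|y * d.2%:~R + z * (vrot d).2%:~R - j%:~R| < 1 &
      `|(y * d.1%:~R + z * (vrot d).1%:~R - i%:~R) +
        (y * d.2%:~R + z * (vrot d).2%:~R - j%:~R)| < 1] <->
  [\/ (i, j) = (0, 0) /\ y + z < 1, (i, j) = d /\ 0 < y | (i, j) = vrot d /\ 0 < z].
Proof.
move=> hd y0 z0 yz; rewrite !ltr_norml; split; last first.
  move=> h; have : exists2 e : vertex, e = (i, j) &
    [\/ e = (0, 0) /\ y + z < 1, e = d /\ 0 < y | e = vrot d /\ 0 < z].
    by exists (i, j).
  move=> [[i' j'] [-> ->]] {h}.
  by move: d hd; apply: unit_steps_ind => -[] [[-> ->] h] /=; split; lra.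
move=> [a1 a2 a3].
have [hi hj] : `|i%:~R : R| < 2 /\ `|j%:~R : R| < 2.
  rewrite !ltr_norml; move: d hd a1 a2 a3.
  by apply: unit_steps_ind => /= a1 a2 a3; split; lra.
move: d hd a1 a2 a3.
by case: (small_int hi) => ->; case: (small_int hj) => ->;
  apply: unit_steps_ind => /= a1 a2 a3;
  first [exfalso; lra | apply: Or31; split; [by []|lra] |
         apply: Or32; split; [by []|lra] | apply: Or33; split; [by []|lra]].
Qed.

Definition face_point (R : realType) (k d : vertex) (x y z : R) : R * R :=
  bary (position R k) (position R (vadd k d)) (position R (vadd k (vrot d))) x y z.

Lemma vadd_inj (k : vertex) : injective (vadd k).
Proof. by move=> [a b] [c d] [/addrI -> /addrI ->]. Qed.

Lemma vaddA (a b c : vertex) : vadd (vadd a b) c = vadd a (vadd b c).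
Proof. by rewrite /vadd /= !addrA. Qed.

Lemma vaddr0 (k : vertex) : vadd k 0 = k.
Proof. by rewrite /vadd /= !addr0; case: k. Qed.

Lemma vunrotK (d : vertex) : vrot (vunrot d) = d.
Proof. by case: d => a b; rewrite /vunrot /vrot /=; congr pair; ring. Qed.

(** Open stars detect which barycentric coordinates are positive, and they do not refer to the face.
    Comparing two descriptions of one point thus compares vertices, without a case analysis on pairs
    of faces. *)
Lemma face_point_star (R : realType) (k d t : vertex) (x y z : R) :
  d \in unit_steps -> 0 <= x -> 0 <= y -> 0 <= z -> x + y + z = 1 ->
  open_star t (face_point k d x y z) <->
  [\/ t = k /\ 0 < x, t = vadd k d /\ 0 < y | t = vadd k (vrot d) /\ 0 < z].
Proof.
move=> hd x0 y0 z0 e1.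
rewrite /open_star lattice1_bary lattice2_bary !lattice1_position !lattice2_position.
have [i [j ->]] : exists i j : int, t = vadd k (i, j).
  by exists (t.1 - k.1), (t.2 - k.2); rewrite /vadd /= !subrKC; case: t.
have -> : x = 1 - y - z by lra.
have yz : y + z <= 1 by lra.
have c1 : (1 - y - z) * k.1%:~R + y * (vadd k d).1%:~R +
    z * (vadd k (vrot d)).1%:~R - (vadd k (i, j)).1%:~R
    = y * d.1%:~R + z * (vrot d).1%:~R - i%:~R :> R.
  by rewrite /= !intrD; ring.
have c2 : (1 - y - z) * k.2%:~R + y * (vadd k d).2%:~R +
    z * (vadd k (vrot d)).2%:~R - (vadd k (i, j)).2%:~R
    = y * d.2%:~R + z * (vrot d).2%:~R - j%:~R :> R.
  by rewrite /= !intrD; ring.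
have c3 (a b c c' : R) : a + b - c - c' = (a - c) + (b - c') by ring.
rewrite c3 c1 c2; have := unit_star i j hd y0 z0 yz => -[h1 h2].
split=> [/h1|] h; [case: h => -[e h]|apply: h2; case: h => -[e h]].
- by apply: Or31; rewrite e vaddr0; split=> //; lra.
- by apply: Or32; rewrite e.
- by apply: Or33; rewrite e.
- by apply: Or31; split; [apply: (@vadd_inj k); rewrite e vaddr0 | lra].
- by apply: Or32; split=> //; exact: vadd_inj e.
- by apply: Or33; split=> //; exact: vadd_inj e.
Qed.

Lemma lerp_face_point (R : realType) (k d : vertex) (t : R) :
  lerp (position R k) (position R (vadd k d)) t = face_point k d (1 - t) t 0.
Proof. by rewrite /lerp /face_point /bary; congr pair; ring. Qed.

Lemma edge_star (R : realType) (a b v : vertex) (t : R) :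
  neighbor a b -> 0 <= t <= 1 ->
  open_star v (lerp (position R a) (position R b) t) <->
  (v = a /\ t < 1) \/ (v = b /\ 0 < t).
Proof.
move=> nab /andP[t0 t1]; pose d : vertex := (b.1 - a.1, b.2 - a.2).
have eb : b = vadd a d by rewrite /vadd /d /= !subrKC; case: (b).
have hd : d \in unit_steps by rewrite -(neighbor_vadd a) -eb.
rewrite eb lerp_face_point; have st : 1 - t + t + 0 = 1 by ring.
have t1' : 0 <= 1 - t by lra.
have [h1 h2] := @face_point_star R a d v (1 - t) t 0 hd t1' t0 (lexx 0) st.
split=> [/h1[] [-> h]|[] [e h]]; last 2 first.
- by apply: h2; apply: Or31; split=> //; lra.
- by apply: h2; apply: Or32.
- by left; split=> //; lra.
- by right.
- by rewrite ltxx in h.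
Qed.

Lemma neighbor_neq (a b : vertex) : neighbor a b -> a <> b.
Proof. by move=> + e; rewrite e /neighbor !subrr. Qed.

Lemma neighborP (a b : vertex) : neighbor a b ->
  exists2 d, d \in unit_steps & b = vadd a d.
Proof.
move=> nab; have eb : b = vadd a (b.1 - a.1, b.2 - a.2).
  by rewrite /vadd /= !subrKC; case: (b).
by exists (b.1 - a.1, b.2 - a.2) => //; rewrite -(neighbor_vadd a) -eb.
Qed.

Lemma face_vrot (k d : vertex) : d \in unit_steps ->
  face k (vadd k d) (vadd k (vrot d)).
Proof.
move=> hd; rewrite /face neighbor_vadd hd [neighbor _ k]neighborC neighbor_vadd.
rewrite vrot_unit // andbT /= neighborC.
by rewrite -(vadd_vrot_vunrot k d) neighbor_vadd vunrot_unit.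
Qed.

Lemma orient_bary (R : realType) (a b c : R * R) (x y z : R) : x + y + z = 1 ->
  [/\ orient a b (bary a b c x y z) = z * orient a b c,
      orient b c (bary a b c x y z) = x * orient a b c &
      orient c a (bary a b c x y z) = y * orient a b c].
Proof.
move=> e; have -> : x = 1 - y - z by lra.
by split; rewrite /orient /cross /vec /bary /=; ring.
Qed.

Lemma bary_orient (R : realType) (a b c p : R * R) : orient a b c != 0 ->
  p = bary a b c (orient b c p / orient a b c) (orient c a p / orient a b c)
        (orient a b p / orient a b c).
Proof.
move=> D0; rewrite [LHS]surjective_pairing /bary; congr pair;
  by move: D0; rewrite /orient /cross /vec /= => D0; field.
Qed.

Definition faces_to_triangles (R : realType) (phi : R * R -> R * R) : Prop :=
  forall u v w, face u v w ->
    phi @` triangle (position R u) (position R v) (position R w) =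
    triangle (phi (position R u)) (phi (position R v)) (phi (position R w)).

Lemma face_cover (R : realType) (phi : R * R -> R * R) (k d : vertex) (x y z : R) :
  let P := fun v => phi (position R v) in
  faces_to_triangles phi -> d \in unit_steps ->
  0 <= x -> 0 <= y -> 0 <= z -> x + y + z = 1 ->
  exists x' y' z' : R, [/\ 0 <= x', 0 <= y', 0 <= z', x' + y' + z' = 1 &
    phi (face_point k d x' y' z') =
    bary (P k) (P (vadd k d)) (P (vadd k (vrot d))) x y z].
Proof.
move=> P phiF hd x0 y0 z0 e.
have : triangle (P k) (P (vadd k d)) (P (vadd k (vrot d)))
    (bary (P k) (P (vadd k d)) (P (vadd k (vrot d))) x y z).
  by apply/triangleP; exists x, y, z.
rewrite -phiF; last exact: face_vrot.
move=> [p /triangleP[x' [y' [z' [x0' y0' z0' e' ->]]]] h].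
by exists x', y', z'.
Qed.

Lemma vrot_neq (d : vertex) : d \in unit_steps -> vrot d <> d /\ vrot d <> vunrot d.
Proof. by move: d; apply: unit_steps_ind. Qed.

(** With w > 0 the point would be in the open star of a + vrot d, which is no vertex of the other
    face. *)
Lemma adjacent_faces_meet (R : realType) (a d : vertex) (x y w x' y' w' : R) :
  d \in unit_steps -> 0 <= x -> 0 <= y -> 0 <= w -> x + y + w = 1 ->
  0 <= x' -> 0 <= y' -> 0 <= w' -> x' + y' + w' = 1 ->
  face_point a d x y w = face_point a (vunrot d) x' y' w' -> w = 0.
Proof.
move=> hd x0 y0 w0 e1 x0' y0' w0' e1' same; have hd' := vunrot_unit hd.
apply/eqP; rewrite eq_le w0 andbT leNgt; apply/negP => wp.
have [_ h2] := face_point_star a (vadd a (vrot d)) hd x0 y0 w0 e1.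
have := h2 (Or33 _ _ (conj erefl wp)); rewrite same.
have [h3 _] := face_point_star a (vadd a (vrot d)) hd' x0' y0' w0' e1'.
move=> /h3 [] [e _].
- by have := @neighbor_neq a (vadd a (vrot d)); rewrite neighbor_vadd vrot_unit // e; apply.
- by case: (vrot_neq hd) => _; apply; exact: vadd_inj e.
- rewrite vunrotK in e.
  by case: (vrot_neq hd) => + _; apply; exact: vadd_inj e.
Qed.

(** A point of the drawn segment belongs to the drawn triangles on both sides. By injectivity its
    two preimages agree, so they lie in both faces, hence on the common edge. *)
Lemma edge_cover (R : realType) (phi : R * R -> R * R) (a b : vertex) (z : R * R) :
  injective phi -> faces_to_triangles phi -> neighbor a b ->
  on_segment (phi (position R a)) (phi (position R b)) z ->
  exists2 y, on_segment (position R a) (position R b) y & phi y = z.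
Proof.
move=> phiI phiF /neighborP[d hd ->] [t /andP[t0 t1] ez].
have hd' := vunrot_unit hd.
have t1' : 0 <= 1 - t by lra.
have st : 1 - t + t + 0 = 1 by ring.
have st' : 1 - t + 0 + t = 1 by ring.
have [x [y [w [x0 y0 w0 e1 h1]]]] :=
  face_cover a phiF hd t1' t0 (lexx 0) st.
have [x' [y' [w' [x0' y0' w0' e1' h1']]]] :=
  face_cover a phiF hd' t1' (lexx 0) t0 st'.
have same : face_point a d x y w = face_point a (vunrot d) x' y' w'.
  apply: phiI; rewrite h1 h1' vunrotK /bary; congr pair; ring.
have w00 := adjacent_faces_meet hd x0 y0 w0 e1 x0' y0' w0' e1' same.
exists (face_point a d x y w); last by rewrite h1 ez /lerp /bary; congr pair; ring.
exists y; first by apply/andP; split; lra.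
by rewrite lerp_face_point w00; congr (face_point _ _ _ _ _); lra.
Qed.

Lemma edge_on_segment (R : realType) (phi : R * R -> R * R) (a b : vertex) (y : R * R) :
  injective phi -> continuous phi -> faces_to_triangles phi -> neighbor a b ->
  on_segment (position R a) (position R b) y ->
  on_segment (phi (position R a)) (phi (position R b)) (phi y).
Proof.
move=> phiI phiC phiF nab; apply: arc_on_segment => // z.
exact: edge_cover.
Qed.

(** Pull the common point back to the lattice. If it is inside the edge a b, it is in the open stars
    of both a and b, so both are ends of c d. *)
Lemma edges_meet (R : realType) (phi : R * R -> R * R) (a b c d : vertex) (z : R * R) :
  let P := fun v => phi (position R v) in
  injective phi -> faces_to_triangles phi -> neighbor a b -> neighbor c d ->
  on_segment (P a) (P b) z -> on_segment (P c) (P d) z ->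
  (a = c /\ b = d \/ a = d /\ b = c) \/
  exists2 v : vertex, z = P v & (v \in [:: a; b]) && (v \in [:: c; d]).
Proof.
move=> P phiI phiF nab ncd sab scd.
have [y [t t01 ->] h1] := edge_cover phiI phiF nab sab.
have [y' [t' t01' ->] h2] := edge_cover phiI phiF ncd scd.
have same := phiI _ _ (etrans h1 (esym h2)).
have meet v : (v = a /\ t < 1) \/ (v = b /\ 0 < t) -> v \in [:: c; d].
  have [_ h3] := edge_star v nab t01; move=> /h3; rewrite same.
  have [h4 _] := edge_star v ncd t01'; move=> /h4.
  by rewrite !inE => -[] [-> _]; rewrite eqxx ?orbT.
have [t0|t0] := eqVneq t 0.
  right; exists a; first by rewrite -h1 t0 lerp0.
  by rewrite meet ?inE ?eqxx //; left; rewrite t0 ltr01.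
have [t1|t1] := eqVneq t 1.
  right; exists b; first by rewrite -h1 t1 lerp1.
  by rewrite meet ?inE ?eqxx ?orbT //; right; rewrite t1 ltr01.
case/andP: t01 => t0' t1'; left.
have ha : a \in [:: c; d] by apply: meet; left; rewrite lt_neqAle t1.
have hb : b \in [:: c; d] by apply: meet; right; rewrite lt_neqAle eq_sym t0.
have nn := neighbor_neq nab.
move: ha hb; rewrite !inE => /orP[]/eqP ea /orP[]/eqP eb; subst;
  by [left | right | case: nn].
Qed.

(** Pull z back to a point of both the edge and the face. If all its weights are positive, three
    distinct vertices are among a and b; if one vanishes, z is on a drawn side and an orientation is
    0. Dividing by D makes the signs independent of the orientation of the face. *)
Lemma edge_off_face (R : realType) (phi : R * R -> R * R) (a b k d : vertex) (z : R * R) :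
  let P := fun v => phi (position R v) in
  let D := orient (P k) (P (vadd k d)) (P (vadd k (vrot d))) in
  injective phi -> continuous phi -> faces_to_triangles phi ->
  neighbor a b -> d \in unit_steps -> D != 0 ->
  on_segment (P a) (P b) z ->
  0 < orient (P k) (P (vadd k d)) z / D ->
  0 < orient (P (vadd k d)) (P (vadd k (vrot d))) z / D ->
  0 < orient (P (vadd k (vrot d))) (P k) z / D -> False.
Proof.
move=> P D phiI phiC phiF nab hd D0 sab o1 o2 o3.
have [p [t t01 ->] h1] := edge_cover phiI phiF nab sab.
have ez := bary_orient z D0.
have [x [y [w [x0 y0 w0 e1 h2]]]] : exists x y w : R,
    [/\ 0 <= x, 0 <= y, 0 <= w, x + y + w = 1 & phi (face_point k d x y w) = z].
  have st : orient (P (vadd k d)) (P (vadd k (vrot d))) z / D +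
      orient (P (vadd k (vrot d))) (P k) z / D + orient (P k) (P (vadd k d)) z / D = 1.
    by rewrite -!mulrDl addrC addrA orient_sum divff.
  have [x [y [w [x0 y0 w0 e1 h]]]] :=
    face_cover k phiF hd (ltW o2) (ltW o3) (ltW o1) st.
  by exists x, y, w; split=> //; rewrite h -ez.
have same := phiI _ _ (etrans h1 (esym h2)).
have nn := neighbor_neq nab.
have inE2 v : [\/ v = k /\ 0 < x, v = vadd k d /\ 0 < y | v = vadd k (vrot d) /\ 0 < w] ->
    v = a \/ v = b.
  have [_ h3] := face_point_star k v hd x0 y0 w0 e1.
  have [h4 _] := edge_star v nab t01.
  by move=> /h3; rewrite -same => /h4 [] [-> _]; [left|right].
have /and3P[n1 n2 n3] := face_vrot k hd.
have [xp|xn] := ltP 0 x; last first.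
  have x00 : x = 0 by lra.
  have : on_segment (P (vadd k d)) (P (vadd k (vrot d))) z.
    rewrite -h2; apply: edge_on_segment => //.
    exists w; first by apply/andP; split; lra.
    have -> : y = 1 - w by lra.
    by rewrite /face_point /bary /lerp x00; congr pair; ring.
  by move=> [s _ es]; move: o2; rewrite es orient_self mul0r ltxx.
have [yp|yn] := ltP 0 y; last first.
  have y00 : y = 0 by lra.
  have : on_segment (P (vadd k (vrot d))) (P k) z.
    rewrite -h2; apply: edge_on_segment => //.
    exists x; first by apply/andP; split; lra.
    have -> : w = 1 - x by lra.
    by rewrite /face_point /bary /lerp y00; congr pair; ring.
  by move=> [s _ es]; move: o3; rewrite es orient_self mul0r ltxx.
have [wp|wn] := ltP 0 w; last first.
  have w00 : w = 0 by lra.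
  have : on_segment (P k) (P (vadd k d)) z.
    rewrite -h2; apply: edge_on_segment => //.
    exists y; first by apply/andP; split; lra.
    have -> : x = 1 - y by lra.
    by rewrite /face_point /bary /lerp w00; congr pair; ring.
  by move=> [s _ es]; move: o1; rewrite es orient_self mul0r ltxx.
have v1 := inE2 k (Or31 _ _ (conj erefl xp)).
have v2 := inE2 _ (Or32 _ _ (conj erefl yp)).
have v3 := inE2 _ (Or33 _ _ (conj erefl wp)).
have m1 := neighbor_neq n1; have m2 := neighbor_neq n2; have m3 := neighbor_neq n3.
by case: v1 v2 v3 => [e2|e2] [e3|e3] [e4|e4];
  [apply: m1|apply: m1|apply: m3|apply: m2|apply: m2|apply: m3|apply: m1|apply: m1];
  congruence.
Qed.

(** * Orientation of the drawn faces *)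

(** For collinear points the dot product is plus or minus the product of the lengths, so one
    triangle inequality is an equality. *)
Lemma nondegenerate_orient (R : realType) (a b c : R * R) :
  len (vec a c) < len (vec a b) + len (vec b c) ->
  len (vec a b) < len (vec a c) + len (vec c b) ->
  len (vec b c) < len (vec b a) + len (vec a c) -> orient a b c != 0.
Proof.
rewrite [len (vec c b)]len_vecC [len (vec b a)]len_vecC => h1 h2 h3.
apply/eqP => D0; have := dot_cross_len (vec a b) (vec a c).
rewrite -/(orient a b c) D0 expr0n addr0 => /eqP; rewrite eqf_sqr => hdot.
have hbc : len (vec b c) ^+ 2 = len (vec a b) ^+ 2 + len (vec a c) ^+ 2
    - 2 * dot (vec a b) (vec a c).
  by rewrite !len_sqr /dot /vec /=; ring.
have := len_ge0 (vec a b); have := len_ge0 (vec a c); have := len_ge0 (vec b c).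
case/orP: hdot => /eqP hdot; rewrite hdot in hbc; nra.
Qed.

Definition face_orient (R : realType) (P : vertex -> R * R) (k d : vertex) : R :=
  orient (P k) (P (vadd k d)) (P (vadd k (vrot d))).

(* Otherwise both triangles would contain a point off their common edge. *)
Lemma adjacent_orient (R : realType) (phi : R * R -> R * R) (k d : vertex) :
  let P := fun v => phi (position R v) in
  injective phi -> continuous phi -> faces_to_triangles phi -> d \in unit_steps ->
  face_orient P k d != 0 -> face_orient P k (vunrot d) != 0 ->
  0 < face_orient P k d * face_orient P k (vunrot d).
Proof.
move=> P phiI phiC phiF hd; rewrite /face_orient vunrotK.
set w := P (vadd k d); set x := P (vadd k (vrot d)); set y := P (vadd k (vunrot d)).
set ox := orient _ _ _; set oy := orient _ _ _ => ox0 oy0.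
rewrite lt_neqAle eq_sym mulf_neq0 //= leNgt; apply/negP => neg.
pose c1 := orient y w x / oy; pose c2 := orient (P k) y x / oy.
pose B := `|c1| + `|c2|.
have B0 : 0 <= B by rewrite addr_ge0.
(* Then (1 - s) / 2 = s B, just enough for z, a point near the middle of the common edge, to have
   nonnegative weights at both ends of that edge in the second triangle. *)
pose s := (1 + 2 * B)^-1.
have s0 : 0 < s by rewrite invr_gt0; lra.
have sB : s * (1 + 2 * B) = 1 by rewrite mulVf // gt_eqF //; lra.
have h0 : 0 <= (1 - s) / 2 by nra.
have st : (1 - s) / 2 + (1 - s) / 2 + s = 1 by field.
pose z := bary (P k) w x ((1 - s) / 2) ((1 - s) / 2) s.
have oz : orient (P k) w z = s * ox by case: (orient_bary (P k) w x st).
have b1 : orient y w z / oy = (1 - s) / 2 + s * c1.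
  have e : c1 * oy = orient y w x by rewrite divfK.
  apply: (mulIf oy0); rewrite divfK //.
  rewrite (_ : _ * oy = (1 - s) / 2 * oy + s * (c1 * oy)); [rewrite e | ring].
  by rewrite /oy /z /orient /cross /vec /bary /=; field.
have b2 : orient (P k) y z / oy = (1 - s) / 2 + s * c2.
  have e : c2 * oy = orient (P k) y x by rewrite divfK.
  apply: (mulIf oy0); rewrite divfK //.
  rewrite (_ : _ * oy = (1 - s) / 2 * oy + s * (c2 * oy)); [rewrite e | ring].
  by rewrite /oy /z /orient /cross /vec /bary /=; field.
have bnd (c : R) : `|c| <= B -> 0 <= (1 - s) / 2 + s * c.
  rewrite ler_norml => /andP[hc _].
  have : s * - B <= s * c by rewrite ler_pM2l.
  lra.
(* Opposite orientations put z on the same side of the common edge as y. *)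
have b3 : 0 <= orient w (P k) z / oy.
  have -> : orient w (P k) z / oy = s * - (ox * oy) / oy ^+ 2.
    have -> : orient w (P k) z = - orient (P k) w z.
      by rewrite /orient /cross /vec /=; ring.
    by rewrite oz; field.
  by rewrite divr_ge0 ?sqr_ge0 // mulr_ge0 ?oppr_ge0 // ltW.
have [x1 [y1 [w1 [x10 y10 w10 e1 f1]]]] := face_cover k phiF hd h0 h0 (ltW s0) st.
have h1 : 0 <= orient y w z / oy by rewrite b1 bnd // lerDl.
have h2 : 0 <= orient (P k) y z / oy by rewrite b2 bnd // lerDr.
have st2 : orient y w z / oy + orient w (P k) z / oy + orient (P k) y z / oy = 1.
  by rewrite -!mulrDl addrC addrA orient_sum divff.
have := face_cover k phiF (vunrot_unit hd) h1 b3 h2 st2.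
rewrite vunrotK => -[x2 [y2 [w2 [x20 y20 w20 e2 f2]]]].
have same : face_point k d x1 y1 w1 = face_point k (vunrot d) x2 y2 w2.
  by apply: phiI; rewrite f1 f2 -bary_orient.
have w00 := adjacent_faces_meet hd x10 y10 w10 e1 x20 y20 w20 e2 same.
have nk : neighbor k (vadd k d) by rewrite neighbor_vadd.
have : on_segment (P k) w z.
  rewrite -[z]f1; apply: (edge_on_segment phiI phiC phiF nk).
  exists y1; first by apply/andP; split; lra.
  by rewrite lerp_face_point w00; congr (face_point _ _ _ _ _); lra.
move=> [t _ et]; have := oz; rewrite et orient_self => /esym/eqP.
by rewrite mulf_eq0 (negbTE ox0) gt_eqF.
Qed.

(** The same face read from its next corner. *)
Lemma face_orient_shift (R : realType) (P : vertex -> R * R) (k d : vertex) :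
  face_orient P (vadd k d) (vrot (vrot d)) = face_orient P k d.
Proof.
rewrite /face_orient !vaddA.
have -> : vadd d (vrot (vrot d)) = vrot d.
  by rewrite /vadd /vrot /=; congr pair; ring.
have -> : vadd d (vrot (vrot (vrot d))) = 0.
  by rewrite /vadd /vrot /=; congr pair; ring.
by rewrite vaddr0 [RHS]orient_rot.
Qed.

(** The sign spreads around a vertex through adjacent faces, then to each neighbouring vertex
    through a shared face, and so along rows to the whole lattice. *)
Lemma face_orient_sign (R : realType) (P : vertex -> R * R) (e : R) :
  (forall k d, d \in unit_steps ->
     0 < face_orient P k d * face_orient P k (vunrot d)) ->
  0 < e * face_orient P 0 (1, 0) ->
  forall k d, d \in unit_steps -> 0 < e * face_orient P k d.
Proof.
move=> adj e0.
have turn k d : d \in unit_steps -> 0 < e * face_orient P k d ->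
    0 < e * face_orient P k (vunrot d).
  move=> hd h; have := adj k d hd => h'.
  have : 0 < e * face_orient P k d * (e * face_orient P k (vunrot d)) * 1.
    have e2 : 0 < e ^+ 2.
      by rewrite exprn_even_gt0 //=; apply: contraTneq h => ->; rewrite mul0r ltxx.
    by rewrite mulr1 mulrACA -expr2 mulr_gt0.
  by rewrite mulr1 pmulr_rgt0.
have all_d k d0 : d0 \in unit_steps -> 0 < e * face_orient P k d0 ->
    forall d, d \in unit_steps -> 0 < e * face_orient P k d.
  move=> h0 h1.
  have u1 := vunrot_unit h0; have t1 := turn _ _ h0 h1.
  have u2 := vunrot_unit u1; have t2 := turn _ _ u1 t1.
  have u3 := vunrot_unit u2; have t3 := turn _ _ u2 t2.
  have u4 := vunrot_unit u3; have t4 := turn _ _ u3 t3.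
  have u5 := vunrot_unit u4; have t5 := turn _ _ u4 t4.
  move: d0 h0 h1 {u1 u2 u3 u4 u5} t1 t2 t3 t4 t5.
  by apply: unit_steps_ind => h1 t1 t2 t3 t4 t5; apply: unit_steps_ind.
have step k : (forall d, d \in unit_steps -> 0 < e * face_orient P k d) ->
    forall c, c \in unit_steps ->
    forall d, d \in unit_steps -> 0 < e * face_orient P (vadd k c) d.
  move=> h c hc; apply: (all_d _ (vrot (vrot c))); first by rewrite !vrot_unit.
  by rewrite face_orient_shift; exact: h.
have row (n : nat) k c : c \in unit_steps ->
    (forall d, d \in unit_steps -> 0 < e * face_orient P k d) ->
    forall d, d \in unit_steps ->
    0 < e * face_orient P (vadd k (c.1 * n%:Z, c.2 * n%:Z)) d.
  move=> hc h; elim: n => [|n IH].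
    have -> : vadd k (c.1 * 0%:Z, c.2 * 0%:Z) = k by rewrite !mulr0 -[RHS]vaddr0.
    exact: h.
  have -> : vadd k (c.1 * n.+1%:Z, c.2 * n.+1%:Z) = vadd (vadd k (c.1 * n%:Z, c.2 * n%:Z)) c.
    by rewrite /vadd /= -addn1 PoszD; congr pair; ring.
  exact: step.
have base := all_d 0 (1, 0) isT e0.
have line (m : int) k c : c \in unit_steps -> (- c.1, - c.2) \in unit_steps ->
    (forall d, d \in unit_steps -> 0 < e * face_orient P k d) ->
    forall d, d \in unit_steps ->
    0 < e * face_orient P (vadd k (c.1 * m, c.2 * m)) d.
  move=> hc hc' h; case: m => n; first exact: row.
  by rewrite NegzE !mulrN -!mulNr; exact: (row n.+1 k (- c.1, - c.2)).
move=> [m n]; have := line n _ (0, 1) isT isT (line m _ (1, 0) isT isT base).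
by rewrite /vadd /= !mul0r !mul1r !add0r !addr0.
Qed.

(** The identity for e = 1 and a reflection for e = -1, so that both orientations are treated at
    once. *)
Definition mirror (R : realType) (e : R) (p : R * R) : R * R := (p.1, e * p.2).

Lemma mirrorK (R : realType) (e : R) : e * e = 1 -> involutive (mirror e).
Proof. by move=> ee p; rewrite /mirror /= mulrA ee mul1r -surjective_pairing. Qed.

Lemma orient_mirror (R : realType) (e : R) (a b c : R * R) :
  orient (mirror e a) (mirror e b) (mirror e c) = e * orient a b c.
Proof. by rewrite /orient /cross /vec /mirror /=; ring. Qed.

Lemma on_segment_mirror (R : realType) (e : R) (a b z : R * R) : e * e = 1 ->
  on_segment (mirror e a) (mirror e b) z -> on_segment a b (mirror e z).
Proof.
move=> ee [t t01 ->]; exists t => //.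
rewrite -[RHS](mirrorK ee); congr mirror.
by rewrite /lerp /mirror /=; congr pair; ring.
Qed.

Lemma len_mirror (R : realType) (e : R) (a b : R * R) : e * e = 1 ->
  len (vec (mirror e a) (mirror e b)) = len (vec a b).
Proof.
move=> ee; rewrite /len /vec /mirror /=; congr (Num.sqrt (_ + _)).
by rewrite -mulrBr exprMn expr2 ee mul1r.
Qed.

Lemma triangulation_drawing (R : realType) (I : vertex -> vertex -> R)
    (r : vertex -> R) :
  inversive_distance_packing I r -> geometric_triangulation I r ->
  exists2 P, hex_drawing P &
    forall u v, neighbor u v -> len (vec (P u) (P v)) = edge_length I r u v.
Proof.
move=> [_ tri] [phi [phiI phiC phiF hl]].
pose P0 v := phi (position R v).
have hlen u v : neighbor u v -> len (vec (P0 u) (P0 v)) = edge_length I r u v.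
  by move=> nuv; rewrite len_vecC -hl.
have nz k d : d \in unit_steps -> face_orient P0 k d != 0.
  move=> hd; have := face_vrot k hd; set u := vadd k d; set w := vadd k _ => f.
  have /and3P[n1 n2 n3] := f.
  have lt a b c : face a b c ->
      len (vec (P0 a) (P0 c)) < len (vec (P0 a) (P0 b)) + len (vec (P0 b) (P0 c)).
    move=> h; have /and3P[m1 m2 m3] := h.
    by rewrite !hlen //; [exact: tri | rewrite neighborC].
  apply: nondegenerate_orient; apply: lt => //.
  - by rewrite /face neighborC n3 neighborC n2 neighborC n1.
  - by rewrite /face neighborC n1 neighborC n3 neighborC n2.
have adj k d (hd : d \in unit_steps) :=
  @adjacent_orient R phi k d phiI phiC phiF hd (nz k d hd) (nz _ _ (vunrot_unit hd)).
pose e : R := if 0 < face_orient P0 0 (1, 0) then 1 else -1.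
have ee : e * e = 1 by rewrite /e; case: ifP => _; rewrite ?mulrNN mulr1.
have e0 : 0 < e * face_orient P0 0 (1, 0).
  rewrite /e; case: ifP => [h|/negbT]; first by rewrite mul1r.
  by rewrite -leNgt => h; rewrite mulN1r oppr_gt0 lt_neqAle h nz.
have pos := face_orient_sign adj e0.
exists (fun v => mirror e (P0 v)); last by move=> u v /hlen <-; rewrite len_mirror.
split.
- by move=> k d hd; rewrite orient_mirror; exact: pos.
- move=> a b c d z nab ncd /(on_segment_mirror ee) s1 /(on_segment_mirror ee) s2.
  have [same|[v ev hv]] := edges_meet phiI phiF nab ncd s1 s2; [by left|right].
  by exists v => //; rewrite /P0 -ev mirrorK.
- move=> a b k d z nab hd /(on_segment_mirror ee) s1.
  rewrite -[z](mirrorK ee) !orient_mirror => o1 o2 o3.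
  have D0 := pos k d hd.
  have quot (t : R) : 0 < e * t -> 0 < t / face_orient P0 k d.
    move=> t0; have en : e != 0 by rewrite /e; case: ifP; rewrite ?oppr_eq0 oner_eq0.
    have -> : t / face_orient P0 k d = e * t / (e * face_orient P0 k d).
      by field; rewrite en nz.
    by rewrite divr_gt0.
  exact: (edge_off_face phiI phiC phiF nab hd (nz k d hd) s1 (quot _ o1) (quot _ o2) (quot _ o3)).
Qed.

(* Multiplication by d in the Eisenstein integers, where (m, n) stands for
   m + n exp (i pi / 3); vrot is the case d = (0, 1). *)
Definition vmul (d v : vertex) : vertex :=
  (v.1 * d.1 - v.2 * d.2, v.1 * d.2 + v.2 * (d.1 + d.2)).

Lemma vmul_vadd (d u v : vertex) : vmul d (vadd u v) = vadd (vmul d u) (vmul d v).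
Proof. by rewrite /vmul /vadd /=; congr pair; ring. Qed.

Lemma vmul_vrot (d v : vertex) : vmul d (vrot v) = vrot (vmul d v).
Proof. by rewrite /vmul /vrot /=; congr pair; ring. Qed.

Lemma vmul_unit (d v : vertex) :
  d \in unit_steps -> v \in unit_steps -> vmul d v \in unit_steps.
Proof. by move: d; apply: unit_steps_ind; move: v; apply: unit_steps_ind. Qed.

Lemma vmul_inj (d : vertex) : d \in unit_steps -> injective (vmul d).
Proof.
move: d; apply: unit_steps_ind => -[a b] [a' b'] [] /= h1 h2; congr pair; lia.
Qed.

(** Orientation-preserving symmetries of the lattice reduce any directed edge to the one from 0 to
    (1, 0). *)
Lemma hex_drawing_relabel (R : realType) (P : vertex -> R * R) (k d : vertex) :
  d \in unit_steps -> hex_drawing P ->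
  hex_drawing (fun v => P (vadd k (vmul d v))).
Proof.
move=> hd [hO hE hF]; pose f v := vadd k (vmul d v).
have fv u c : f (vadd u c) = vadd (f u) (vmul d c).
  by rewrite /f vmul_vadd vaddA.
have fI : injective f by move=> u v /vadd_inj /(vmul_inj hd).
have fn u v : neighbor u v -> neighbor (f u) (f v).
  by move=> /neighborP[c hc ->]; rewrite fv neighbor_vadd vmul_unit.
split.
- move=> u c hc; rewrite -!/(f _) !fv vmul_vrot; apply: hO; exact: vmul_unit.
- move=> a b c c' z /fn n1 /fn n2 s1 s2.
  have [[[/fI -> /fI ->]|[/fI -> /fI ->]]|[v ez /andP[v1 v2]]] := hE _ _ _ _ _ n1 n2 s1 s2.
  + by left; left.
  + by left; right.
  + right; move: v1 v2 ez; rewrite !inE => /orP[]/eqP -> h ez.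
    * by exists a => //; rewrite !inE eqxx /=; case/orP: h => /eqP/fI ->; rewrite eqxx ?orbT.
    * by exists b => //; rewrite !inE eqxx orbT /=; case/orP: h => /eqP/fI ->; rewrite eqxx ?orbT.
- move=> a b u c z /fn n1 hc s1; rewrite -!/(f _) !fv vmul_vrot.
  by apply: hF n1 _ s1; exact: vmul_unit.
Qed.

Theorem lemma3p4 (R : realType) (I : vertex -> vertex -> R)
    (I_sym : symmetric_on_edges I)
    (I_gt : forall u v : vertex, neighbor u v -> - (1 / 2) < I u v)
    (v0 : vertex) :
  exists C : R, 0 < C /\
    forall r : vertex -> R,
      inversive_distance_packing I r ->
      geometric_triangulation I r ->
      forall vk : vertex, neighbor v0 vk -> r v0 <= C * r vk.
Proof.
pose bound (d : vertex) (C : R) := d \in unit_steps -> forall r : vertex -> R,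
  inversive_distance_packing I r -> geometric_triangulation I r ->
  r v0 <= C * r (v0.1 - d.1, v0.2 - d.2).
have /choice[C hC] : forall d, exists C, bound d C.
  (* The constant is found for each direction d from vk to v0; the value 0 is a default for pairs d
     that are no direction. *)
  move=> d; rewrite /bound; have [hd|hd] := boolP (d \in unit_steps); last by exists 0.
  (* This symmetry sends 0 to vk and (1, 0) to v0. *)
  pose f v := vadd (v0.1 - d.1, v0.2 - d.2) (vmul d v).
  have f0 : f 0 = (v0.1 - d.1, v0.2 - d.2).
    by rewrite /f /vadd /vmul /= !mul0r subrr !addr0.
  have f1 : f (1, 0) = v0.
    by rewrite /f /vadd /vmul /= !mul0r !mul1r subr0 addr0 !subrK; case: (v0).
  have fn u v : neighbor u v -> neighbor (f u) (f v).
    by move=> /neighborP[c hc ->]; rewrite /f vmul_vadd -vaddA neighbor_vadd vmul_unit.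
  have [u v /fn/I_gt //|D [_ hD]] := @drawing_ring_lemma R (fun u v => I (f u) (f v)).
  exists D => _ r pack geo; have [P hP hl] := triangulation_drawing pack geo.
  have r0 := pack.1.
  have := hD (fun v => r (f v)) _ (fun v => r0 _) (hex_drawing_relabel (v0.1 - d.1, v0.2 - d.2) hd hP).
  rewrite f0 f1; apply => u v /fn nuv; rewrite hl // sqr_sqrtr //.
  have p : 0 < r (f u) * r (f v) by rewrite mulr_gt0.
  have h : - (r (f u) * r (f v)) <= 2 * I (f u) (f v) * (r (f u) * r (f v)).
    by rewrite -mulN1r ler_wpM2r ?ltW //; have := I_gt _ _ nuv; lra.
  have := sqr_ge0 (r (f u) - r (f v)); nra.
(* The six constants have a common bound; the maximum with 1 makes it positive. *)
have [M hM] := seq_upper_bound C unit_steps.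
exists (Num.max 1 M); split; first by rewrite lt_max ltr01.
move=> r pack geo vk; rewrite neighborC => /neighborP[d hd ev].
have := hC d hd r pack geo; have -> : (v0.1 - d.1, v0.2 - d.2) = vk.
  by rewrite ev /vadd /= !addrK; case: (vk).
move=> h; apply: le_trans h _; apply: ler_wpM2r; first exact: ltW (pack.1 _).
by rewrite le_max hM // orbT.
Qed.
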